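(* Consider the nonautonomous control system and its control flow $\Phi$ described in the context. (i) If $E\subset\Omega\times M$ is a chain control set, then the lift $$\mathcal{E}:=\{(u,\omega,x)\in\mathcal{U}\times\Omega\times M : \psi(t,\omega,x,u)\in E\text{ for all }t\in\mathbb{R}\}$$ is a maximal invariant chain transitive set for the control flow $\Phi$. (ii) Conversely, let $\mathcal{E}\subset\mathcal{U}\times\Omega\times M$ be a maximal invariant chain transitive set for $\Phi$. Then the projection to $\Omega\times M$, $$\pi_{\Omega\times M}\mathcal{E}:=\{(\omega,x)\in\Omega\times M : \exists u\in\mathcal{U}\text{ with }(u,\omega,x)\in\mathcal{E}\},$$ is a chain control set.
   Context: Setting. $M$ is a connected $d$-dimensional $C^\infty$-manifold with tangent bundle $TM$; $\Omega$ is a compact metric space with a minimal continuous flow $\sigma:\mathbb{R}\times\Omega\to\Omega$, written $\sigma(t,\omega)=\omega\cdot t$. The maps $f_0,\dots,f_m:\Omega\times M\to TM$ are continuous and every $f_i(\omega,\cdot)$ is a $C^1$ vector field on $M$. $U\subset\mathbb{R}^m$ is compact and convex and $\mathcal{U}=\{u\in L^\infty(\mathbb{R},\mathbb{R}^m): u(t)\in U \text{ for almost all } t\in\mathbb{R}\}$, endowed with a metric compatible with the weak$^*$ topology of $L^\infty(\mathbb{R},\mathbb{R}^m)=(L^1(\mathbb{R},\mathbb{R}^m))^*$ (so $\mathcal{U}$ is compact). The control system is $\dot x(t)=f_0(\omega\cdot t,x(t))+\sum_{i=1}^m u_i(t)f_i(\omega\cdot t,x(t))$, $u\in\mathcal{U}$.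 For all $(\omega,x_0,u)\in\Omega\times M\times\mathcal{U}$ there is a unique (Carathéodory) solution $\varphi(t,\omega,x_0,u)$ with $\varphi(0,\omega,x_0,u)=x_0$, assumed to exist for all $t\in\mathbb{R}$. Put $\psi(t,\omega,x,u)=(\omega\cdot t,\varphi(t,\omega,x,u))$ and $\theta_tu=u(t+\cdot)$. The control flow is $\Phi_t(u,\omega,x)=\Phi(t,u,\omega,x)=(\theta_tu,\omega\cdot t,\varphi(t,\omega,x,u))$ on $\mathcal{U}\times\Omega\times M$. The letter $d$ denotes the metrics on $\Omega$, on $\mathcal{U}$, and a fixed metric on $M$ compatible with its topology; products carry the maximum metric. Controlled chains. For $\varepsilon,T>0$, a controlled $(\varepsilon,T)$-chain from $(\omega,x)$ to $(\overline\omega,y)$ in $\Omega\times M$ is given by $n\in\mathbb{N}$ ($n\ge1$), points $(\omega_0,x_0)=(\omega,x),(\omega_1,x_1),\dots,(\omega_n,x_n)=(\omega_n,y)\in\Omega\times M$, controls $u_0,\dots,u_{n-1}\in\mathcal{U}$ and times $T_0,\dots,T_{n-1}\ge T$ such that $\omega_j\cdot T_j=\omega_{j+1}$ and $d(\varphi(T_j,\omega_j,x_j,u_j),x_{j+1})<\varepsilon$ for $j=0,\dots,n-1$, and $d(\omega_n,\overline\omega)<\varepsilon$. A chain control set is a nonvoid set $E\subset\Omega\times M$, maximal (with respect to inclusion) with the properties: (i) for all $(\omega,x)\in E$ there is $u\in\mathcal{U}$ with $\psi(t,\omega,x,u)\in E$ for all $t\in\mathbb{R}$; (ii) for all $(\omega,x),(\overline\omega,y)\in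 E$ and all $\varepsilon,T>0$ there is a controlled $(\varepsilon,T)$-chain from $(\omega,x)$ to $(\overline\omega,y)$. Chains for $\Phi$. For $\varepsilon,T>0$, an $(\varepsilon,T)$-chain for $\Phi$ from $(u,\omega,x)$ to $(v,\overline\omega,y)$ is given by $n\in\mathbb{N}$ ($n\ge 1$), elements $(u_0,\omega_0,x_0)=(u,\omega,x),(u_1,\omega_1,x_1),\dots,(u_n,\omega_n,x_n)=(v,\omega_n,y)$ of $\mathcal{U}\times\Omega\times M$ and times $T_0,\dots,T_{n-1}\ge T$ such that $\omega_j\cdot T_j=\omega_{j+1}$ and $d\big((\theta_{T_j}u_j,\varphi(T_j,\omega_j,x_j,u_j)),(u_{j+1},x_{j+1})\big)<\varepsilon$ for $j=0,\dots,n-1$, and $d(\omega_n,\overline\omega)<\varepsilon$ (no jumps in $\Omega$ are allowed). A nonvoid set $\mathcal{E}\subset\mathcal{U}\times\Omega\times M$ is chain transitive for $\Phi$ if for all $(u,\omega,x),(v,\overline\omega,y)\in\mathcal{E}$ and all $\varepsilon,T>0$ there is an $(\varepsilon,T)$-chain from $(u,\omega,x)$ to $(v,\overline\omega,y)$. It is invariant if $\Phi_t(\mathcal{E})\subset\mathcal{E}$ for all $t\in\mathbb{R}$. A maximal invariant chain transitive set is a set that is maximal with respect to inclusion among the invariant chain transitive sets. *)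

(* Defs.v *)
From HB Require Import structures.
From mathcomp Require Import all_boot all_order all_algebra.
From mathcomp Require Import all_classical all_reals all_analysis.
From mathcomp Require Import measurable_realfun ess_sup_inf.

Set Implicit Arguments.
Unset Strict Implicit.
Unset Printing Implicit Defensive.

Import Order.TTheory GRing.Theory Num.Theory.
Import numFieldNormedType.Exports.

Local Open Scope classical_set_scope.
Local Open Scope ring_scope.

(* [f] is of class C^n on the open set [D]. In finite dimension, continuity of
   the derivative is continuity of [x |-> 'd f x v] for every [v]. *)
Fixpoint Ck (R : realType) (V W : normedModType R) (n : nat) (D : set V)
    (f : V -> W) : Prop :=
  match n with
  | 0 => forall x, D x -> {for x, continuous f}
  | n'.+1 => (forall x, D x -> differentiable f x) /\
             (forall v, Ck n' D (fun x => 'd f x v))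
  end.

(* [chart_inv] is the inverse homeomorphism; its values outside the open set
   [chart_coord @` chart_dom] are irrelevant, and so are the values of
   [chart_coord] outside [chart_dom]. *)
Record chart (R : realType) (d : nat) (M : topologicalType) := Chart {
  chart_dom : set M ;
  chart_coord : M -> 'rV[R]_d ;
  chart_inv : 'rV[R]_d -> M ;
  chart_dom_open : open chart_dom ;
  chart_img_open : open (chart_coord @` chart_dom) ;
  chart_coordK : forall x, chart_dom x -> chart_inv (chart_coord x) = x ;
  chart_coord_continuous :
    forall x, chart_dom x -> {for x, continuous chart_coord} ;
  chart_inv_continuous :
    forall y, (chart_coord @` chart_dom) y -> {for y, continuous chart_inv}
}.

Definition transition (R : realType) (d : nat) (M : topologicalType)
    (c c' : chart R d M) : 'rV[R]_d -> 'rV[R]_d :=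
  chart_coord c' \o chart_inv c.

Record smooth_atlas (R : realType) (d : nat) (M : topologicalType) := SmoothAtlas {
  atlas_index : Type ;
  atlas_chart :> atlas_index -> chart R d M ;
  atlas_cover : forall x, exists i, chart_dom (atlas_chart i) x ;
  atlas_smooth : forall i j n,
    Ck n (chart_coord (atlas_chart i) @`
            (chart_dom (atlas_chart i) `&` chart_dom (atlas_chart j)))
         (transition (atlas_chart i) (atlas_chart j))
}.

(* A tangent vector at [p] is the family of its coordinate vectors in the charts
   around [p], related by the derivatives of the transition maps. The last field
   only normalizes the irrelevant entries. *)
Record tangent (R : realType) (d : nat) (M : topologicalType)
    (A : smooth_atlas R d M) (p : M) := Tangent {
  tcoord :> atlas_index A -> 'rV[R]_d ;
  tcoord_transition : forall i j, chart_dom (A i) p -> chart_dom (A j) p ->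
    tcoord j = 'd (transition (A i) (A j)) (chart_coord (A i) p) (tcoord i) ;
  tcoord_out : forall i, ~ chart_dom (A i) p -> tcoord i = 0
}.

(* Continuity into the total space TM of a map that sends (w, x) to a vector of
   T_x M. The topology of TM is the one for which the sets TM|_(chart_dom i) are
   open and homeomorphic to [chart_dom i * R^d] through the coordinates [i]. *)
Definition continuous_field (R : realType) (d : nat) (Omega M : topologicalType)
    (A : smooth_atlas R d M) (f : Omega -> forall x : M, tangent A x) : Prop :=
  forall (i : atlas_index A) (w : Omega) (x : M), chart_dom (A i) x ->
    {for (w, x), continuous (fun p : Omega * M => f p.1 p.2 i)}.

Definition C1_vector_field (R : realType) (d : nat) (M : topologicalType)
    (A : smooth_atlas R d M) (X : forall x : M, tangent A x) : Prop :=
  forall i : atlas_index A,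
    Ck 1 (chart_coord (A i) @` chart_dom (A i))
         (fun y => X (chart_inv (A i) y) i).

Definition continuous_flow (R : realType) (Omega : topologicalType)
    (sigma : R -> Omega -> Omega) : Prop :=
  [/\ forall w, sigma 0 w = w,
      forall s t w, sigma (s + t) w = sigma s (sigma t w) &
      continuous (fun p : R * Omega => sigma p.1 p.2)].

Definition minimal_flow (R : realType) (Omega : topologicalType)
    (sigma : R -> Omega -> Omega) : Prop :=
  forall K : set Omega, closed K -> K !=set0 ->
    (forall t w, K w -> K (sigma t w)) -> K = setT.

Section translation.
Variable R : realType.
Notation mu := (@lebesgue_measure R).

Lemma measurable_translate (t : R) :
  measurable_fun [set: measurableTypeR R]
    ((fun s => t + s) : measurableTypeR R -> measurableTypeR R).
Proof. by apply: measurable_funD => //; exact: measurable_id. Qed.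

Lemma lebesgue_measure_translate (t : R) (A : set (measurableTypeR R)) :
  measurable A -> mu ((fun s : measurableTypeR R => t + s) @^-1` A) = mu A.
Proof.
move=> mA; have mt := measurable_translate t.
pose m : {measure set (measurableTypeR R) -> \bar R} :=
  measure_function_pushforward__canonical__measure_function_Measure mu mt.
apply/esym; rewrite (@lebesgue_measure_unique R m)//.
move=> _ [[a b] _ <-] /=.
rewrite /pushforward /=.
have -> : (fun s : measurableTypeR R => t + s) @^-1` `]a, b]%classic =
          `](a - t), (b - t)]%classic.
  apply/seteqP; split => s /=; rewrite !in_itv/= ltrBlDl lerBrDl; exact.
rewrite !lebesgue_measure_itv/= !lte_fin ltrD2r; case: ifP => // _.
by rewrite -!EFinB; congr (_%:E); rewrite opprB addrA subrK.
Qed.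

Lemma ae_translate (t : R) (P : R -> Prop) :
  {ae mu, forall s, P s} -> {ae mu, forall s, P (t + s)}.
Proof.
move=> [N [mN N0 PN]]; exists ((fun s => t + s) @^-1` N); split.
- by rewrite -[X in measurable X]setTI; exact: (measurable_translate t).
- by rewrite lebesgue_measure_translate.
- by move=> s /PN.
Qed.

End translation.

Definition Linfty (R : realType) := LspaceType (@lebesgue_measure R) (leey 1).
Definition L1 (R : realType) := LspaceType (@lebesgue_measure R) (lexx 1%E).

Section shift.
Variable R : realType.
Notation mu := (@lebesgue_measure R).
Implicit Types (t : R) (u : Linfty R).

Definition Linfty_shift_fun t u : measurableTypeR R -> measurableTypeR R :=
  fun s => u (t + s).

Let measurable_Linfty_shift_fun t u : measurable_fun setT (Linfty_shift_fun t u).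
Proof.
by apply: (measurableT_comp _ (measurable_translate t)); exact: measurable_funPT.
Qed.

HB.instance Definition _ t u :=
  isMeasurableFun.Build _ _ _ _ (Linfty_shift_fun t u) (@measurable_Linfty_shift_fun t u).

(* the class of [s |-> u (t + s)], see [Linfty_shiftE] below *)
Definition Linfty_shift_class t u : {mfun_ mu, measurableTypeR R >-> measurableTypeR R} :=
  \pi_({mfun_ mu, measurableTypeR R >-> measurableTypeR R})%qT
    ([the {mfun _ >-> _} of Linfty_shift_fun t u]).

Lemma Linfty_shift_classE t u : {ae mu, forall s, Linfty_shift_class t u s = u (t + s)}.
Proof.
have : (\pi_({mfun_ mu, measurableTypeR R >-> measurableTypeR R})
    (repr (Linfty_shift_class t u)) = Linfty_shift_class t u)%qT by exact: reprK.
rewrite {2}/Linfty_shift_class => /eqquotP /asboolP.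
by apply: filterS => s /(_ I).
Qed.

Lemma finite_norm_Linfty_shift t u : finite_norm mu +oo (Linfty_shift_class t u : _ -> R).
Proof.
have := @Lebesgue_finite _ _ _ _ _ _ u.
rewrite /finite_norm unlock /Lnorm; case: ifP => // _ ufin.
apply: le_lt_trans ufin; apply/ess_supP.
have := ess_sup_ge mu (abse \o (EFin \o (u : _ -> R))).
move=> /(@ae_translate _ t); apply: filterS2 (Linfty_shift_classE t u) => s /= ->.
exact.
Qed.

HB.instance Definition _ t u :=
  isFinLebesgue.Build _ _ _ mu _ (leey 1) (Linfty_shift_class t u) (finite_norm_Linfty_shift t u).

Definition Linfty_shift t u : Linfty R := [the Linfty R of Linfty_shift_class t u].

Lemma Linfty_shiftE t u : {ae mu, forall s, Linfty_shift t u s = u (t + s)}.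
Proof. exact: Linfty_shift_classE. Qed.

End shift.

(* L^oo(R, R^m), as m-tuples of elements of L^oo(R, R) *)
Definition control_value (R : realType) (m : nat) (u : 'I_m -> Linfty R) (s : R) :
  'rV[R]_m := \row_i u i s.

Record control (R : realType) (m : nat) (U : set 'rV[R]_m) := Control {
  control_val :> 'I_m -> Linfty R ;
  controlP : {ae @lebesgue_measure R, forall s, U (control_value control_val s)}
}.

HB.instance Definition _ (R : realType) (m : nat) (U : set 'rV[R]_m) :=
  gen_eqMixin (control U).
HB.instance Definition _ (R : realType) (m : nat) (U : set 'rV[R]_m) :=
  gen_choiceMixin (control U).

Lemma control_shiftP (R : realType) (m : nat) (U : set 'rV[R]_m) (t : R)
    (u : control U) :
  {ae @lebesgue_measure R, forall s, U (control_value (fun i => Linfty_shift t (u i)) s)}.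
Proof.
have h : {ae @lebesgue_measure R, forall s, forall i, Linfty_shift t (u i) s = u i (t + s)}.
  by apply: filter_forall => i; exact: Linfty_shiftE.
apply: filterS2 h (ae_translate t (controlP u)) => s h.
by congr (U _); apply/rowP => i; rewrite !mxE h.
Qed.

Definition control_shift (R : realType) (m : nat) (U : set 'rV[R]_m) (t : R)
  (u : control U) : control U := Control (control_shiftP t u).

Definition pairing (R : realType) (m : nat) (U : set 'rV[R]_m) (u : control U)
    (g : 'I_m -> L1 R) : R :=
  \int[@lebesgue_measure R]_s (\sum_(i < m) u i s * g i s).

(* the topology induced on [control U] by the weak* topology of the dual of
   L^1(R, R^m) *)
Definition weak_star (R : realType) (m : nat) (U : set 'rV[R]_m) : topologicalType :=
  initial_topology (fun u : control U => pairing u : {ptws ('I_m -> L1 R) -> R}).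

Definition is_metric (R : realType) (T : Type) (dist : T -> T -> R) : Prop :=
  [/\ forall x y, 0 <= dist x y,
      forall x y, dist x y = 0 <-> x = y,
      forall x y, dist x y = dist y x &
      forall x y z, dist x z <= dist x y + dist y z].

Definition weak_star_compatible (R : realType) (m : nat) (U : set 'rV[R]_m)
    (dU : control U -> control U -> R) : Prop :=
  forall B : set (control U), open (B : set (weak_star U)) <->
    forall u, B u -> exists2 e, 0 < e & forall v, dU u v < e -> B v.

(* Right-hand side along the curve [x], in the coordinates of chart [i] *)
Definition control_rhs (R : realType) (d m : nat) (Omega M : topologicalType)
    (A : smooth_atlas R d M) (U : set 'rV[R]_m) (sigma : R -> Omega -> Omega)
    (f0 : Omega -> forall x : M, tangent A x)
    (f : 'I_m -> Omega -> forall x : M, tangent A x)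
    (w : Omega) (u : control U) (x : R -> M) (i : atlas_index A) (t : R) :
    'rV[R]_d :=
  f0 (sigma t w) (x t) i + \sum_(k < m) u k t *: f k (sigma t w) (x t) i.

(* Caratheodory solutions on the whole line: continuous curves that satisfy the
   integral equation in every chart, on every interval mapped into its domain *)
Definition solution (R : realType) (d m : nat) (Omega M : topologicalType)
    (A : smooth_atlas R d M) (U : set 'rV[R]_m) (sigma : R -> Omega -> Omega)
    (f0 : Omega -> forall x : M, tangent A x)
    (f : 'I_m -> Omega -> forall x : M, tangent A x)
    (w : Omega) (u : control U) (x : R -> M) : Prop :=
  continuous x /\
  forall (i : atlas_index A) (a b : R), a <= b ->
    (forall t, a <= t <= b -> chart_dom (A i) (x t)) ->
    forall k : 'I_d,
      chart_coord (A i) (x b) ord0 k - chart_coord (A i) (x a) ord0 k =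
      \int[@lebesgue_measure R]_(t in `[a, b]%classic)
        control_rhs sigma f0 f w u x i t ord0 k.

Definition solution_map (R : realType) (d m : nat) (Omega M : topologicalType)
    (A : smooth_atlas R d M) (U : set 'rV[R]_m) (sigma : R -> Omega -> Omega)
    (f0 : Omega -> forall x : M, tangent A x)
    (f : 'I_m -> Omega -> forall x : M, tangent A x)
    (phi : R -> Omega -> M -> control U -> M) : Prop :=
  forall w x0 (u : control U),
    [/\ solution sigma f0 f w u (fun t => phi t w x0 u),
        phi 0 w x0 u = x0 &
        forall x : R -> M, solution sigma f0 f w u x -> x 0 = x0 ->
          forall t, x t = phi t w x0 u].

Section control_flow.
Variables (R : realType) (m : nat) (U : set 'rV[R]_m) (Omega M : metricType R).
Variables (sigma : R -> Omega -> Omega) (phi : R -> Omega -> M -> control U -> M).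
Variable dU : control U -> control U -> R.

Definition psi (t : R) (w : Omega) (x : M) (u : control U) : Omega * M :=
  (sigma t w, phi t w x u).

Definition Phi (t : R) (p : control U * Omega * M) : control U * Omega * M :=
  let: (u, w, x) := p in (control_shift t u, sigma t w, phi t w x u).

(* Only [ws j], [xs j] with [j <= n] and [us j], [Ts j] with [j < n] matter. *)
Definition controlled_chain (eps T : R) (p q : Omega * M) : Prop :=
  exists (n : nat) (ws : nat -> Omega) (xs : nat -> M) (us : nat -> control U)
      (Ts : nat -> R),
    [/\ (0 < n)%N, (ws 0%N, xs 0%N) = p, xs n = q.2, mdist (ws n) q.1 < eps &
        forall j, (j < n)%N ->
          [/\ T <= Ts j, sigma (Ts j) (ws j) = ws j.+1 &
              mdist (phi (Ts j) (ws j) (xs j) (us j)) (xs j.+1) < eps]].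

Definition controlled_chain_transitive (E : set (Omega * M)) : Prop :=
  [/\ E !=set0,
      forall w x, E (w, x) -> exists u : control U, forall t, E (psi t w x u) &
      forall p q, E p -> E q -> forall eps T, 0 < eps -> 0 < T ->
        controlled_chain eps T p q].

Definition chain_control_set (E : set (Omega * M)) : Prop :=
  controlled_chain_transitive E /\
  forall E', controlled_chain_transitive E' -> E `<=` E' -> E' = E.

Definition Phi_chain (eps T : R) (p q : control U * Omega * M) : Prop :=
  exists (n : nat) (us : nat -> control U) (ws : nat -> Omega) (xs : nat -> M)
      (Ts : nat -> R),
    [/\ (0 < n)%N, (us 0%N, ws 0%N, xs 0%N) = p,
        us n = q.1.1 /\ xs n = q.2, mdist (ws n) q.1.2 < eps &
        forall j, (j < n)%N ->
          [/\ T <= Ts j, sigma (Ts j) (ws j) = ws j.+1 &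
              Num.max (dU (control_shift (Ts j) (us j)) (us j.+1))
                (mdist (phi (Ts j) (ws j) (xs j) (us j)) (xs j.+1)) < eps]].

Definition chain_transitive (EE : set (control U * Omega * M)) : Prop :=
  EE !=set0 /\
  forall p q, EE p -> EE q -> forall eps T, 0 < eps -> 0 < T ->
    Phi_chain eps T p q.

Definition Phi_invariant (EE : set (control U * Omega * M)) : Prop :=
  forall t, Phi t @` EE `<=` EE.

Definition maximal_invariant_chain_transitive
    (EE : set (control U * Omega * M)) : Prop :=
  [/\ Phi_invariant EE, chain_transitive EE &
      forall EE', Phi_invariant EE' -> chain_transitive EE' -> EE `<=` EE' ->
        EE' = EE].

Definition control_lift (E : set (Omega * M)) : set (control U * Omega * M) :=
  [set p | let: (u, w, x) := p in forall t, E (psi t w x u)].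

Definition state_projection (EE : set (control U * Omega * M)) : set (Omega * M) :=
  [set p | exists u : control U, EE (u, p.1, p.2)].

End control_flow.

(* Main.v *)
Require Import Defs.
From HB Require Import structures.
From mathcomp Require Import all_boot all_order all_algebra.
From mathcomp Require Import all_classical all_reals all_analysis.
From mathcomp Require Import measurable_realfun ess_sup_inf ring lra.

Set Implicit Arguments.
Unset Strict Implicit.
Unset Printing Implicit Defensive.

Import Order.TTheory GRing.Theory Num.Theory.
Import numFieldNormedType.Exports.

Local Open Scope classical_set_scope.
Local Open Scope ring_scope.

(** A controlled chain forgets the controls at its jumps, so the projection of an
    invariant chain transitive set for the control flow is controlled chain
    transitive.  The converse is the point: if [E] is controlled chain
    transitive, then its lift is chain transitive ([control_lift_transitive]).
    Granted this, both maximality claims are formal, because an invariant set is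
    contained in the lift of any set containing its projection, and by viability
    a controlled chain transitive set is contained in the projection of its lift.

    To join (u, w, x) to (v, w', y) in the lift, move forward along the first
    trajectory for a long time and backward along the second one for a long time
    S'; both end points lie in [E] and are joined by a controlled chain.  All the
    controls involved are concatenated into a single control on the line, so that
    along the chain the control component is just shifted and never jumps.  It
    jumps only twice: next to the beginning, to a control that agrees with the
    shift of u up to a large time, and at the end, to v from a control that agrees
    with it from a very negative time on.  Both jumps are small because controls
    that agree on a long interval around 0 are weak* close: the tails of finitely
    many integrable functions are small, uniformly over the bounded set of
    controls ([weak_star_tail]).

    The controlled chain ends at a base point that is only close to the prescribed
    one, and the last step follows v from that base point.  So phi S' must be
    continuous in the base point ([phi_base_continuous]).  The fields need not be
    Lipschitz in the state uniformly in the base point, so no Gronwall estimate is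
    available, and continuity is deduced from uniqueness.  Along an
    ultrafilter of base points converging to ws the solutions stay, for a short
    time, in a compact ball of a chart with a common Lipschitz constant; they
    converge pointwise, hence locally uniformly, to a curve that again satisfies
    the integral equations, in all charts at once ([solution_on_limit]), and this
    curve is the solution over ws by uniqueness ([phi_unique_on]).  A real
    induction extends the convergence to all positive times. *)

(** * Real induction, ultrafilters and row vectors *)

Lemma rV_norm_coord (R : realType) (n : nat) (x : 'rV[R]_n) k :
  `|x ord0 k| <= `|x|.
Proof.
rewrite [leRHS]/Num.Def.normr/= mx_normrE.
exact: (le_bigmax _ (fun i : 'I_1 * 'I_n => `|x i.1 i.2|) (ord0, k)).
Qed.

Lemma rV_norm_le (R : realType) (n : nat) (x : 'rV[R]_n) e : 0 <= e ->
  (forall k, `|x ord0 k| <= e) -> `|x| <= e.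
Proof.
move=> e0 xe; rewrite [leLHS]/Num.Def.normr/= mx_normrE.
by apply: bigmax_le => // -[i j] _; rewrite ord1.
Qed.

Lemma rV_closed_ball_compact (R : realType) (n : nat) (y : 'rV[R]_n) (r : R) :
  compact [set y' | `|y' - y| <= r].
Proof.
have -> : [set y' | `|y' - y| <= r] = closed_ball_ Num.Def.normr y r.
  by apply/seteqP; split=> y' /=; rewrite distrC.
apply: bounded_closed_compact; last exact: closed_closed_ball_.
exists (`|y| + r); split; first by rewrite num_real.
move=> e ye y' /= y'r; rewrite (le_trans _ (ltW ye))//.
by rewrite -[y'](subrK y) addrC (le_trans (ler_normD _ _))// lerD2l distrC.
Qed.

(** For a <= b, the map q |-> max a (min b q) is the projection onto [a, b]. *)
Lemma clamp_lipschitz (R : realDomainType) (a b q q' : R) :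
  `|Num.max a (Num.min b q) - Num.max a (Num.min b q')| <= `|q - q'|.
Proof.
have maxL x y : `|Num.max a x - Num.max a y| <= `|x - y|.
  have h1 := ler_norm (x - y); have h2 := ler_norm (y - x); rewrite distrC in h2.
  by rewrite !maxEle; do 2?[case: ifPn; rewrite -?ltNge => ?]; rewrite ler_norml; lra.
have minL x y : `|Num.min b x - Num.min b y| <= `|x - y|.
  have h1 := ler_norm (x - y); have h2 := ler_norm (y - x); rewrite distrC in h2.
  by rewrite !minEle; do 2?[case: ifPn; rewrite -?ltNge => ?]; rewrite ler_norml; lra.
exact: le_trans (maxL _ _) (minL _ _).
Qed.

(** A property holds on [a, b] if it holds at a, extends a little to the right of
    any [a, t] on which it holds, and holds at t whenever it holds on [a, t[. *)
Lemma real_induction (R : realType) (P : R -> Prop) (a b : R) :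
  P a ->
  (forall t, a <= t -> t < b -> (forall s, a <= s <= t -> P s) ->
     exists2 e, 0 < e & forall s, t < s -> s < t + e -> s <= b -> P s) ->
  (forall t, a < t -> t <= b -> (forall s, a <= s < t -> P s) -> P t) ->
  forall t, a <= t <= b -> P t.
Proof.
move=> Pa Pright Pleft t /andP[at_ tb].
pose S := [set r | a <= r <= b /\ forall s, a <= s <= r -> P s].
have Sa : S a.
  split=> [|s sa]; first by rewrite lexx (le_trans at_).
  by have -> : s = a by apply/le_anti; rewrite andbC.
have ubS : ubound S b by move=> r [/andP[]].
have supS : has_sup S by split; [exists a|exists b].
set c := sup S.
have ac : a <= c by apply: ub_le_sup => //; exists b.
have cb : c <= b by apply: ge_sup => //; exists a.
have Pc' s : a <= s -> s < c -> P s.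
  move=> as_ sc; have sc0 : 0 < c - s by rewrite subr_gt0.
  have [r [_ Pr] sr] := sup_adherent sc0 supS.
  by apply: Pr; rewrite as_ ltW//; move: sr; rewrite subKr.
have Pc s : a <= s <= c -> P s.
  move=> /andP[as_]; rewrite le_eqVlt => /predU1P[->|]; last exact: Pc'.
  move: ac; rewrite le_eqVlt => /predU1P[<-//|ac'].
  by apply: Pleft => // r /andP[]; exact: Pc'.
suff bc : b <= c by apply: Pc; rewrite at_ (le_trans tb).
rewrite leNgt; apply/negP => cltb.
have [e e0 Pe] := Pright c ac cltb Pc.
pose r := Num.min (c + e / 2) b.
have cr : c < r by rewrite lt_min cltb andbT ltrDl divr_gt0.
have Sr : S r.
  split=> [|s /andP[as_ sr]]; first by rewrite (ltW (le_lt_trans ac cr)) ge_min lexx orbT.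
  have [sc|cs] := leP s c; first by apply: Pc; rewrite as_.
  apply: Pe => //; last by apply: (le_trans sr); rewrite ge_min lexx orbT.
  apply: (le_lt_trans sr); rewrite gt_min ltrD2l.
  by rewrite ltr_pdivrMr// ltr_pMr// ltr1n.
by have := ub_le_sup (ex_intro _ b ubS) Sr; rewrite leNgt cr.
Qed.

(** Convergence can be tested on ultrafilters. *)
Lemma cvg_ultra (T : Type) (S : topologicalType) (F : set_system T) (h : T -> S) (l : S) :
  Filter F -> (forall G, UltraFilter G -> F `<=` G -> h @ G --> l) -> h @ F --> l.
Proof.
move=> FF hG V Vl; apply: contrapT => nV.
have PF : ProperFilter (within (~` (h @^-1` V)) F).
  split; last exact: within_filter.
  rewrite /within/= => nF; apply: nV; apply: filterS nF => x /= nx.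
  by apply: contrapT.
have [G [GU FG]] := ultraFilterLemma PF.
have GV : G (h @^-1` V).
  by apply: hG Vl => // A FA; apply: FG; apply: filterS FA => x Ax _.
have GnV : G (~` (h @^-1` V)).
  by apply: FG; rewrite /within/=; apply: filterS (@filterT _ F _) => x _.
by have [x []] := filter_ex (filterI GV GnV).
Qed.

Lemma ultra_cvg_compact (T : Type) (S : topologicalType) (G : set_system T)
    (h : T -> S) (K : set S) :
  UltraFilter G -> compact K -> G (h @^-1` K) -> exists2 l, K l & h @ G --> l.
Proof.
move=> GU cK GK; have [l [Kl cl]] := cK (h @ G) _ GK.
exists l => // V Vl; have [//|nV] := in_ultra_setVsetC (h @^-1` V) GU.
by have [y []] := cl (~` V) V nV Vl.
Qed.

(** * Lebesgue integrals over compact intervals *)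

Section integrals.
Variable R : realType.
Notation mu := (@lebesgue_measure R).

(** The filter lemmas for almost-everywhere statements, with the domain of the
    predicates fixed so that unification finds the measure. *)
Lemma ae_imply (P Q : measurableTypeR R -> Prop) : (forall s, P s -> Q s) ->
  {ae mu, forall s, P s} -> {ae mu, forall s, Q s}.
Proof. by move=> PQ h; apply: filterS h => s; exact: PQ. Qed.

Lemma ae_imply2 (P P' Q : measurableTypeR R -> Prop) : (forall s, P s -> P' s -> Q s) ->
  {ae mu, forall s, P s} -> {ae mu, forall s, P' s} -> {ae mu, forall s, Q s}.
Proof. by move=> PQ h h'; apply: filterS2 h h' => s; exact: PQ. Qed.

Lemma ae_all (I : finType) (P : I -> measurableTypeR R -> Prop) :
  (forall i, {ae mu, forall s, P i s}) -> {ae mu, forall s, forall i, P i s}.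
Proof. by move=> h; apply: filter_forall => i; exact: h. Qed.

Lemma ae_bounded_Rintegral_itv (a b c : R) (g : R -> R) :
  a <= b -> 0 <= c -> measurable_fun `[a, b]%classic g ->
  {ae mu, forall s, `[a, b]%classic s -> `|g s| <= c} ->
  mu.-integrable `[a, b]%classic (EFin \o g) /\
  `|\int[mu]_(s in `[a, b]%classic) g s| <= c * (b - a).
Proof.
move=> ab c0 mg gc.
have mab : mu `[a, b]%classic = (b - a)%:E.
  rewrite lebesgue_measure_itv/= lte_fin lt_neqAle ab andbT.
  by case: eqVneq => [->|//]; rewrite subrr.
have bnd : (\int[mu]_(s in `[a, b]%classic) `|(g s)%:E| <= c%:E * (b - a)%:E)%E.
  rewrite -mab; apply: integral_le_bound => //; first exact/measurable_EFinP.
have ig : mu.-integrable `[a, b]%classic (EFin \o g).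
  apply/integrableP; split; first exact/measurable_EFinP.
  by apply: le_lt_trans bnd _; rewrite -EFinM ltry.
split=> //; apply: le_trans (le_normr_Rintegral _ ig) _ => //.
rewrite -lee_fin EFinM; apply: le_trans bnd; rewrite /Rintegral fineK //.
by apply: integrable_fin_num => //; exact: (integrable_norm ig).
Qed.

Lemma Rintegral_ae_eq (D : set (measurableTypeR R)) (g h : R -> R) : measurable D ->
  measurable_fun D g -> measurable_fun D h ->
  {ae mu, forall s, D s -> g s = h s} ->
  \int[mu]_(s in D) g s = \int[mu]_(s in D) h s.
Proof.
move=> mD mg mh gh; congr fine; apply: ae_eq_integral => //.
- exact/measurable_EFinP.
- exact/measurable_EFinP.
- by apply: filterS gh => s gh Ds /=; rewrite gh.
Qed.

Lemma Rintegral_itv_cat (g : R -> R) (a c b : R) : a <= c -> c <= b ->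
  mu.-integrable `[a, b]%classic (EFin \o g) ->
  \int[mu]_(s in `[a, b]%classic) g s =
  \int[mu]_(s in `[a, c]%classic) g s + \int[mu]_(s in `[c, b]%classic) g s.
Proof.
move=> ac cb ig; apply/eqP; rewrite addrC -subr_eq; apply/eqP.
rewrite Rintegral_itvB ?bnd_simp// Rintegral_itv_obnd_cbnd//.
by apply: integrableS ig => //; apply: subset_itv; rewrite bnd_simp.
Qed.

Lemma continuous_itv_measurable (a b : R) (g : R -> R) :
  (forall s, a <= s <= b -> {for s, continuous g}) ->
  measurable_fun `[a, b]%classic g.
Proof.
move=> cg; apply: subspace_continuous_measurable_fun => //.
apply: continuous_in_subspaceT => s; rewrite inE/= in_itv/=; exact: cg.
Qed.

Lemma continuous_itv_bounded (a b : R) (g : R -> R) :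
  (forall s, a <= s <= b -> {for s, continuous g}) ->
  exists2 c, 0 <= c & forall s, a <= s <= b -> `|g s| <= c.
Proof.
move=> cg; have : {within `[a, b], continuous (g : R -> R^o)}.
  apply: continuous_in_subspaceT => s; rewrite inE/= in_itv/=; exact: cg.
move=> /continuous_compact/(_ (@segment_compact _ _ _))/compact_bounded[M [_ h]].
exists (`|M| + 1) => [|s sab]; first by rewrite addr_ge0.
apply: h; first by rewrite ltr_pwDr// ler_norm.
by exists s => //=; rewrite in_itv.
Qed.

Lemma Rintegral_translate (t a b : R) (g : R -> R) :
  measurable_fun `[t + a, t + b]%classic g ->
  mu.-integrable `[a, b]%classic (fun s => (g (t + s))%:E) ->
  \int[mu]_(s in `[a, b]%classic) g (t + s) =
  \int[mu]_(s in `[t + a, t + b]%classic) g s.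
Proof.
move=> mg ig; pose D : set (measurableTypeR R) := `[t + a, t + b]%classic.
have DE : (fun s : measurableTypeR R => t + s) @^-1` D = `[a, b]%classic.
  by apply/seteqP; split=> s; rewrite /D /= !in_itv/= !lerD2l.
have mgD : measurable_fun [set: measurableTypeR R] (EFin \o (g \_ D)).
  apply/measurable_EFinP; apply/(measurable_restrictT _ _).1 => //; exact: measurable_itv.
have gDE s : `[a, b]%classic s -> (g \_ D) (t + s) = g (t + s).
  by rewrite -DE => Ds; rewrite patchE mem_set.
transitivity (\int[mu]_(s in D) (g \_ D) s); last first.
  by apply: eq_Rintegral => s Ds; rewrite patchE Ds.
rewrite /Rintegral; congr fine.
pose m : {measure set (measurableTypeR R) -> \bar R} :=
  measure_function_pushforward__canonical__measure_function_Measure mu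
    (measurable_translate t).
rewrite (@eq_measure_integral _ _ _ D m); last first.
  by move=> E mE _; rewrite [RHS]lebesgue_measure_translate.
rewrite (integral_pushforward (measurable_translate t) mgD)//.
- by rewrite DE; apply: eq_integral => s; rewrite inE => sab /=; rewrite gDE.
- rewrite DE; apply: eq_integrable ig => // s; rewrite inE => sab /=.
  by rewrite gDE.
- exact: measurable_itv.
Qed.

Lemma ae_gt_ge (c : R) (P : R -> Prop) : {ae mu, forall s, c < s -> P s} ->
  {ae mu, forall s, c <= s -> P s}.
Proof.
have : {ae mu, forall s, s != c}.
  exists [set c]; split; [exact: measurable_set1|exact: lebesgue_measure_set1|].
  by move=> s /= /negP; rewrite negbK => /eqP.
by apply: ae_imply2 => s sc Ps cs; apply: Ps; rewrite lt_neqAle eq_sym sc.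
Qed.

(** The integrands are s |-> g0 s + sum_k u_k s * g_k s, with essentially bounded
    measurable u_k and continuous g0, g_k: this is the form both of a coordinate
    of the right-hand side along a curve and of the difference of two of them for
    the same control. *)
Section affine.
Variables (m : nat) (u : 'I_m -> R -> R) (B : R).
Hypothesis mu_ : forall k, measurable_fun [set: measurableTypeR R] (u k).
Hypothesis uB : forall k, {ae mu, forall s, `|u k s| <= B}.
Variables (a b : R) (g0 : R -> R) (g : 'I_m -> R -> R).
Hypothesis cg0 : forall s, a <= s <= b -> {for s, continuous g0}.
Hypothesis cg : forall k s, a <= s <= b -> {for s, continuous (g k)}.

Lemma affine_measurable :
  measurable_fun `[a, b]%classic (fun s => g0 s + \sum_(k < m) u k s * g k s).
Proof.
apply: measurable_funD; first exact: continuous_itv_measurable.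
apply: measurable_sum => k; apply: measurable_funM.
  by apply: measurable_funTS; exact: mu_.
by apply: continuous_itv_measurable; exact: cg.
Qed.

Lemma affine_Rintegral_bound c : a <= b -> 0 <= B ->
  (forall s, a <= s <= b -> `|g0 s| <= c) ->
  (forall k s, a <= s <= b -> `|g k s| <= c) ->
  mu.-integrable `[a, b]%classic
    (EFin \o (fun s => g0 s + \sum_(k < m) u k s * g k s)) /\
  `|\int[mu]_(s in `[a, b]%classic) (g0 s + \sum_(k < m) u k s * g k s)| <=
    c * (1 + m%:R * B) * (b - a).
Proof.
move=> ab B0 g0c gc.
have c0 : 0 <= c by apply: le_trans (normr_ge0 (g0 a)) (g0c _ _); rewrite lexx.
apply: ae_bounded_Rintegral_itv => //.
- by rewrite mulr_ge0// addr_ge0// mulr_ge0.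
- exact: affine_measurable.
have uBk := ae_all uB.
apply: (ae_imply _ uBk) => s us; rewrite /= in_itv/= => sab.
apply: le_trans (ler_normD _ _) _; rewrite mulrDr mulr1 lerD ?g0c//.
apply: le_trans (ler_norm_sum _ _ _) _.
apply: (@le_trans _ _ (\sum_(k < m) (B * c))).
  by apply: ler_sum => k _; rewrite normrM ler_pM ?gc ?us.
by rewrite sumr_const card_ord -[leLHS]mulr_natl mulrA mulrC lexx.
Qed.

Lemma affine_integrable : a <= b -> 0 <= B ->
  mu.-integrable `[a, b]%classic
    (EFin \o (fun s => g0 s + \sum_(k < m) u k s * g k s)).
Proof.
move=> ab B0; have [c0 c0_ge0 h0] := continuous_itv_bounded cg0.
have /choice[c cP] : forall k, exists c,
    0 <= c /\ forall s, a <= s <= b -> `|g k s| <= c.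
  by move=> k; have [c c_ge0 hc] := @continuous_itv_bounded a b _ (fun s => @cg k s); exists c.
pose C := c0 + \sum_k c k.
apply: (proj1 (@affine_Rintegral_bound C ab B0 _ _)) => [s sab|k s sab].
  by rewrite (le_trans (h0 _ sab))// lerDl sumr_ge0// => k _; case: (cP k).
apply: (le_trans ((cP k).2 _ sab)); rewrite /C (bigD1 k)//= addrCA lerDl.
by rewrite addr_ge0// sumr_ge0// => j _; case: (cP j).
Qed.
End affine.

End integrals.

(** * Controls *)

Section controls.
Variables (R : realType) (m : nat) (U : set 'rV[R]_m).
Notation mu := (@lebesgue_measure R).

Section Linfty_of.
Variables (h : measurableTypeR R -> measurableTypeR R) (B : R).
Hypothesis mh : measurable_fun setT h.
Hypothesis hB : {ae mu, forall s, `|h s| <= B}.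

#[local] HB.instance Definition _ := isMeasurableFun.Build _ _ _ _ h mh.

Let cls : {mfun_ mu, measurableTypeR R >-> measurableTypeR R} :=
  \pi_({mfun_ mu, measurableTypeR R >-> measurableTypeR R})%qT ([the {mfun _ >-> _} of h]).

Let clsE : {ae mu, forall s, cls s = h s}.
Proof.
have : (\pi_({mfun_ mu, measurableTypeR R >-> measurableTypeR R}) (repr cls) = cls)%qT
  by exact: reprK.
rewrite {2}/cls => /eqquotP /asboolP; by apply: filterS => s /(_ I).
Qed.

Let cls_finite : finite_norm mu +oo (cls : _ -> R).
Proof.
rewrite /finite_norm unlock /Lnorm; case: ifP => // _.
apply: (@le_lt_trans _ _ B%:E); last exact: ltry.
apply/ess_supP; apply: filterS2 clsE hB => s /= ->; by rewrite lee_fin.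
Qed.

#[local] HB.instance Definition _ :=
  isFinLebesgue.Build _ _ _ mu _ (leey 1) cls cls_finite.

(** A measurable function bounded almost everywhere defines a class in L^oo. *)
Lemma ae_bounded_Linfty : exists l : Linfty R, {ae mu, forall s, l s = h s}.
Proof. by exists [the Linfty R of cls]; exact: clsE. Qed.

End Linfty_of.

Hypothesis cptU : compact U.

Lemma control_bounded : exists2 B : R, 0 <= B &
  forall (u : control U) k, {ae mu, forall s, `|u k s| <= B}.
Proof.
have /compact_bounded[M0 [_ h]] := cptU.
exists (`|M0| + 1) => [|u k]; first by rewrite addr_ge0.
apply: (ae_imply _ (controlP u)) => s us.
have := rV_norm_coord (control_value u s) k; rewrite mxE => /le_trans; apply.
by apply: h us; rewrite ltr_pwDr ?ler_norm.
Qed.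

Lemma measurable_control (u : control U) k :
  measurable_fun [set: measurableTypeR R] (u k).
Proof. exact: measurable_funPT. Qed.

(** The concatenation at time c: follow u up to time c, then v restarted at its
    time 0. *)
Lemma control_concat (c : R) (u v : control U) : exists w : control U, forall k,
  {ae mu, forall s, (s <= c -> w k s = u k s) /\ (c < s -> w k s = v k (- c + s))}.
Proof.
have [B B0 uB] := control_bounded.
pose h k : measurableTypeR R -> measurableTypeR R :=
  fun s => if s <= c then u k s else v k (- c + s).
have /choice[l lE] : forall k, exists l : Linfty R, {ae mu, forall s, l s = h k s}.
  move=> k; apply: (@ae_bounded_Linfty (h k) B).
    apply: measurable_fun_ifT.
    - by apply: measurable_fun_ler => //; exact: measurable_id.
    - exact: measurable_control.
    - exact: (measurableT_comp (measurable_control v k) (measurable_translate (- c))).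
  have vB := @ae_translate _ (- c) (fun s => `|v k s| <= B) (uB v k).
  by apply: (ae_imply2 _ (uB u k) vB) => s us vs; rewrite /h; case: ifP.
have lU : {ae mu, forall s, U (control_value l s)}.
  have aU := ae_translate (- c) (controlP v).
  have aUV : {ae mu, forall s, U (control_value u s) /\ U (control_value v (- c + s))}.
    by apply: (ae_imply2 _ (controlP u) aU).
  apply: (ae_imply2 _ (ae_all lE) aUV) => s ls [us vs].
  have [sc|cs] := leP s c.
    have -> : control_value l s = control_value u s; last by [].
    by apply/rowP => k; rewrite !mxE ls /h sc.
  have -> : control_value l s = control_value v (- c + s); last by [].
  by apply/rowP => k; rewrite !mxE ls /h leNgt cs.
exists (Control lU) => k; apply: (ae_imply _ (lE k)) => s /= ->; rewrite /h.
by split=> [->//|]; rewrite ltNge => /negbTE ->.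
Qed.

Lemma measurable_L1 (g : L1 R) : measurable_fun [set: measurableTypeR R] g.
Proof. exact: measurable_funPT. Qed.

Lemma L1_integrable (g : L1 R) : mu.-integrable setT (EFin \o (g : R -> R)).
Proof.
apply/integrableP; split; first by apply/measurable_EFinP; exact: measurable_L1.
by have := @Lebesgue_finite _ _ _ _ _ _ g; rewrite /finite_norm Lnorm1.
Qed.

(** Controls that agree with u on larger and larger intervals converge to u weakly*,
    by dominated convergence. *)
Lemma pairing_cvg (u : control U) (v : nat -> control U) (g : 'I_m -> L1 R) :
  (forall n k, {ae mu, forall s, `|s| <= n%:R -> v n k s = u k s}) ->
  pairing (v n) g @[n --> \oo] --> pairing u g.
Proof.
move=> vu; have [B B0 uB] := control_bounded.
have mprod (w : control U) : measurable_fun [set: measurableTypeR R]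
    (fun s => (\sum_(i < m) w i s * g i s)%:E).
  apply/measurable_EFinP; apply: measurable_sum => k; apply: measurable_funM.
    exact: measurable_control.
  exact: measurable_L1.
have ae_cvg : {ae mu, forall s, [set: measurableTypeR R] s ->
    (fun n => (\sum_(i < m) v n i s * g i s)%:E) @ \oo -->
    (\sum_(i < m) u i s * g i s)%:E}.
  have ae_n : {ae mu, forall s, forall n k, `|s| <= n%:R -> v n k s = u k s}.
    by apply/ae_foralln => n; exact: ae_all (vu n).
  apply: (ae_imply _ ae_n) => s vs _; apply: cvg_near_cst.
  have [N sN] : exists N : nat, `|s| <= N%:R.
    by exists (Num.bound `|s|); rewrite ltW// archi_boundP.
  exists N => // n /= Nn; congr (_%:E); apply: eq_bigr => k _; rewrite vs//.
  by rewrite (le_trans sN)// ler_nat.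
have dom_int : mu.-integrable [set: measurableTypeR R] (fun s => (\sum_(i < m) B * `|g i s|)%:E).
  rewrite (funext (fun s => esym (sumEFin _ _ (fun i => B * `|g i s|)))).
  apply: integrable_sum => // k _; under eq_fun do rewrite EFinM.
  by apply: integrableZl => //; exact: integrable_norm (L1_integrable (g k)).
have dom : {ae mu, forall s n, [set: measurableTypeR R] s ->
    (`|(\sum_(i < m) v n i s * g i s)%:E| <= (\sum_(i < m) B * `|g i s|)%:E)%E}.
  have ae_n : {ae mu, forall s, forall n k, `|v n k s| <= B}.
    by apply/ae_foralln => n; exact: ae_all (uB (v n)).
  apply: (ae_imply _ ae_n) => s vs n _; rewrite lee_fin.
  apply: (le_trans (ler_norm_sum _ _ _)); apply: ler_sum => k _.
  by rewrite normrM ler_wpM2r.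
have [iu _ cv] := dominated_convergence measurableT (fun n => mprod (v n)) (mprod u)
  ae_cvg dom_int dom.
apply: fine_cvg; rewrite /pairing /Rintegral fineK//.
exact: integrable_fin_num.
Qed.

(** A control that agrees with u on a large interval around 0 is close to u. *)
Lemma weak_star_tail (dU : control U -> control U -> R) (u : control U) (e : R) :
  is_metric dU -> weak_star_compatible dU -> 0 < e ->
  exists2 N, 0 <= N & forall v : control U,
    (forall k, {ae mu, forall s, `|s| <= N -> v k s = u k s}) -> dU u v < e.
Proof.
move=> [_ d0 dsym dtri] dUw e0; apply: contrapT => nN.
have /choice[v vP] : forall n : nat, exists v : control U,
    (forall k, {ae mu, forall s, `|s| <= n%:R -> v k s = u k s}) /\ ~ dU u v < e.
  move=> n; apply: contrapT => nv; apply: nN; exists n%:R => // v vu.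
  by apply: contrapT => duv; apply: nv; exists v.
have oB : open ([set v | dU u v < e] : set (weak_star U)).
  apply/dUw => w /= uw; exists (e - dU u w); first by rewrite subr_gt0.
  by move=> w' ww'; apply: le_lt_trans (dtri u w w') _; rewrite -ltrBrDl.
have cv : v @ \oo --> (u : weak_star U).
  move=> V /= [_ [[W oW <-] Wu sWV]].
  have pv : (fun n => pairing (v n)) @ \oo --> (pairing u : {ptws ('I_m -> L1 R) -> R}).
    apply/cvg_sup => g V' /= [_ [[W' oW' <-] W'u sWV']].
    have : nbhs (pairing u g) W' by exact: open_nbhs_nbhs.
    have vu n := (vP n).1.
    move=> nW'; have nW'n : \forall n \near \oo, W' (pairing (v n) g).
      exact: (pairing_cvg vu nW').
    suff : \forall n \near \oo, V' (pairing (v n)) by [].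
    by apply: filterS nW'n => n W'n; exact: sWV'.
  have : nbhs (pairing u : {ptws ('I_m -> L1 R) -> R}) W by exact: open_nbhs_nbhs.
  move=> nW; have nWn : \forall n \near \oo, W (pairing (v n)) by exact: (pv W nW).
  suff : \forall n \near \oo, V (v n) by [].
  by apply: filterS nWn => n Wn; exact: sWV.
have nB : nbhs (u : weak_star U) [set v | dU u v < e].
  by apply: open_nbhs_nbhs; split => //=; rewrite (d0 u u).2.
have dn : \forall n \near \oo, dU u (v n) < e by exact: (cv _ nB).
by have [n dn'] := filter_ex dn; case: (vP n) => _ /(_ dn').
Qed.

End controls.

(** * Solutions: gluing, translation and uniqueness *)

Section control_system.
Variables (R : realType) (d m : nat) (Omega M : metricType R).
Variables (A : smooth_atlas R d M) (U : set 'rV[R]_m).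
Variables (sigma : R -> Omega -> Omega).
Variables (f0 : Omega -> forall x : M, tangent A x).
Variables (f : 'I_m -> Omega -> forall x : M, tangent A x).
Hypothesis flow : continuous_flow sigma.
Hypothesis cf0 : continuous_field f0.
Hypothesis cf : forall i, continuous_field (f i).
Hypothesis cptU : compact U.
Notation mu := (@lebesgue_measure R).

Lemma control_rhsE w (u : control U) (x : R -> M) i s k :
  control_rhs sigma f0 f w u x i s ord0 k =
  f0 (sigma s w) (x s) i ord0 k +
  \sum_(j < m) u j s * f j (sigma s w) (x s) i ord0 k.
Proof. by rewrite /control_rhs mxE summxE; congr (_ + _); apply: eq_bigr => j _; rewrite mxE. Qed.

Lemma flow0 w : sigma 0 w = w. Proof. by case: flow. Qed.
Lemma flowD s t w : sigma (s + t) w = sigma s (sigma t w).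
Proof. by case: flow. Qed.

Lemma flow_continuous w : continuous (fun s => sigma s w).
Proof.
case: flow => _ _ cs s.
exact: (cvg_comp2 cvg_id (cvg_cst w) (cs (s, w))).
Qed.

Lemma field_continuous (g : Omega -> forall x : M, tangent A x) w (x : R -> M) i s k :
  continuous_field g -> continuous x -> chart_dom (A i) (x s) ->
  {for s, continuous (fun s => g (sigma s w) (x s) i ord0 k)}.
Proof.
move=> cg cx Ds.
have gc : g (sigma r w) (x r) i @[r --> s] --> g (sigma s w) (x s) i.
  apply: (@continuous2_cvg _ _ _ _ (nbhs s) _ _ _ (fun w x => g w x i)).
  - exact: (cg i (sigma s w) (x s) Ds).
  - exact: flow_continuous.
  - exact: cx.
exact: (cvg_comp _ _ gc (@coord_continuous R 1 d ord0 k _)).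
Qed.

(** The integral equations of a solution, required only on the compact intervals
    contained in J; they hold in every chart.  Continuity of the curve is not part
    of the notion: the curves are continuous on the whole line, and their values
    outside J do not matter. *)
Definition solution_on (J : set R) (w : Omega) (u : control U) (x : R -> M) : Prop :=
  forall (i : atlas_index A) (a b : R), a <= b ->
    (forall t, a <= t <= b -> J t /\ chart_dom (A i) (x t)) ->
    forall k : 'I_d,
      chart_coord (A i) (x b) ord0 k - chart_coord (A i) (x a) ord0 k =
      \int[mu]_(t in `[a, b]%classic) control_rhs sigma f0 f w u x i t ord0 k.

Lemma solution_onT w u x :
  solution sigma f0 f w u x <-> continuous x /\ solution_on setT w u x.
Proof.
split=> -[cx h]; split=> // i a b ab D k; first by apply: h => // t /D[].
by apply: h => // t /D.
Qed.

Lemma solution_onS (J J' : set R) w u x : J' `<=` J ->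
  solution_on J w u x -> solution_on J' w u x.
Proof. by move=> JJ h i a b ab D k; apply: h => // t /D[/JJ]. Qed.

Lemma rhs_measurable w (u : control U) (x : R -> M) i a b k :
  continuous x -> (forall t, a <= t <= b -> chart_dom (A i) (x t)) ->
  measurable_fun `[a, b]%classic
    (fun t => control_rhs sigma f0 f w u x i t ord0 k).
Proof.
move=> cx D.
rewrite (funext (fun t => control_rhsE w u x i t k)).
apply: affine_measurable => [j|s /D Ds|j s /D Ds]; first exact: measurable_control.
- exact: field_continuous.
- exact: field_continuous.
Qed.

Lemma rhs_integrable w (u : control U) (x : R -> M) i a b k : a <= b ->
  continuous x -> (forall t, a <= t <= b -> chart_dom (A i) (x t)) ->
  mu.-integrable `[a, b]%classic
    (EFin \o (fun t => control_rhs sigma f0 f w u x i t ord0 k)).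
Proof.
move=> ab cx D; have [B B0 uB] := control_bounded cptU.
rewrite (funext (fun t => control_rhsE w u x i t k)).
apply: (@affine_integrable _ _ _ B) => // [j|s /D Ds|j s /D Ds].
- exact: measurable_control.
- exact: field_continuous.
- exact: field_continuous.
Qed.

Lemma solution_on_ae J w (u v : control U) x : continuous x ->
  (forall k, {ae mu, forall s, J s -> u k s = v k s}) ->
  solution_on J w u x -> solution_on J w v x.
Proof.
move=> cx /ae_all uv h i a b ab D k.
have Dx t : a <= t <= b -> chart_dom (A i) (x t) by move=> /D[].
rewrite (h _ _ _ ab D); apply: Rintegral_ae_eq; [exact: measurable_itv|
  exact: rhs_measurable|exact: rhs_measurable|].
apply: (ae_imply _ uv) => s us; rewrite /= in_itv/= => /D[Js _].
by rewrite !control_rhsE; congr (_ + _); apply: eq_bigr => j _; rewrite us.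
Qed.

(** The curve equal to x up to time c and to y afterwards. *)
Definition glue (c : R) (x y : R -> M) : R -> M :=
  fun t => if t <= c then x t else y t.

Lemma glue_continuous c x y : continuous x -> continuous y -> x c = y c ->
  continuous (glue c x y).
Proof.
move=> cx cy xy t V; case: (ltgtP t c) => [tc|tc|->].
- rewrite {1}/glue ltW// => /cx; rewrite /nbhs/=.
  apply: filterS2 (lt_nbhsl tc) => s sc; by rewrite /= /glue ltW.
- rewrite {1}/glue leNgt tc => /cy; rewrite /nbhs/=.
  apply: filterS2 (lt_nbhsr tc) => s sc; by rewrite /= /glue leNgt sc.
- rewrite {1}/glue lexx => Vc.
  have Vx : \forall s \near c, V (x s) by exact: (cx c V Vc).
  have Vy : \forall s \near c, V (y s) by apply: (cy c V); rewrite -xy.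
  suff : \forall s \near c, V (glue c x y s) by [].
  by apply: filterS2 Vx Vy => s; rewrite /= /glue; case: ifP.
Qed.

Lemma solution_on_glue J c w u x y : continuous x -> continuous y -> x c = y c ->
  solution_on (J `&` [set t | t <= c]) w u x ->
  solution_on (J `&` [set t | c <= t]) w u y ->
  solution_on J w u (glue c x y).
Proof.
move=> cx cy xy solx soly i a b ab D k.
have gx t : t <= c -> glue c x y t = x t by rewrite /glue => ->.
have gy t : c <= t -> glue c x y t = y t.
  by rewrite le_eqVlt => /predU1P[<-|ct]; [rewrite gx|rewrite /glue leNgt ct].
have left_part e : a <= e -> e <= b -> e <= c ->
    chart_coord (A i) (glue c x y e) ord0 k - chart_coord (A i) (glue c x y a) ord0 k =
    \int[mu]_(t in `[a, e]%classic) control_rhs sigma f0 f w u (glue c x y) i t ord0 k.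
  move=> ae eb ec; rewrite !gx ?(le_trans ae)// solx//.
    apply: eq_Rintegral => t; rewrite inE/= in_itv/= => /andP[_ te].
    by rewrite /control_rhs gx// (le_trans te).
  move=> t /andP[at_ te]; have tc := le_trans te ec.
  by rewrite -gx//; have [] := D t; rewrite ?at_ ?(le_trans te).
have right_part e : a <= e -> e <= b -> c <= e ->
    chart_coord (A i) (glue c x y b) ord0 k - chart_coord (A i) (glue c x y e) ord0 k =
    \int[mu]_(t in `[e, b]%classic) control_rhs sigma f0 f w u (glue c x y) i t ord0 k.
  move=> ae eb ce; rewrite !gy ?(le_trans ce)// soly//.
    apply: eq_Rintegral => t; rewrite inE/= in_itv/= => /andP[et _].
    by rewrite /control_rhs gy// (le_trans ce).
  move=> t /andP[et tb]; have ct := le_trans ce et.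
  by rewrite -gy//; have [] := D t; rewrite ?tb ?(le_trans ae).
have [bc|cb] := leP b c; first exact: left_part.
have [ca|ac] := leP c a; first exact: right_part.
rewrite (@Rintegral_itv_cat _ _ a c b) ?(ltW ac) ?(ltW cb)//; last first.
  apply: rhs_integrable => //; first exact: glue_continuous.
  by move=> t /D[].
rewrite -left_part ?(ltW ac) ?(ltW cb)// -right_part ?(ltW ac) ?(ltW cb)//.
by rewrite [RHS]addrC subrKA.
Qed.

Lemma solution_on_shift J s w u x : continuous x ->
  solution_on J w u x ->
  solution_on [set t | J (s + t)] (sigma s w) (control_shift s u) (fun t => x (s + t)).
Proof.
move=> cx solx i a b ab D k.
have Dx t : s + a <= t <= s + b -> J t /\ chart_dom (A i) (x t).
  move=> tab; have := D (t - s); rewrite /= subrKC; apply.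
  by rewrite lerBrDl lerBlDl.
rewrite solx ?lerD2l//.
have cxs : continuous (fun t => x (s + t)).
  move=> t; apply: (@continuous_comp _ _ _ (fun t => s + t) x); last exact: cx.
  by apply: cvgD; [exact: cvg_cst|exact: cvg_id].
have E : (fun t => control_rhs sigma f0 f w u x i (s + t) ord0 k) =
  (fun t => f0 (sigma t (sigma s w)) (x (s + t)) i ord0 k +
  \sum_(j < m) u j (s + t) * f j (sigma t (sigma s w)) (x (s + t)) i ord0 k).
  by apply/funext => t; rewrite control_rhsE -!flowD [t + s]addrC.
have mu_ j : measurable_fun [set: measurableTypeR R] (fun t => u j (s + t)).
  exact: (measurableT_comp (measurable_control u j) (measurable_translate s)).
have Da t : a <= t <= b -> chart_dom (A i) (x (s + t)) by move=> /D[].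
rewrite -Rintegral_translate; last 2 first.
- by apply: rhs_measurable => // t /Dx[].
- have [B B0 uB] := control_bounded cptU.
  rewrite -/(EFin \o (fun t => control_rhs sigma f0 f w u x i (s + t) ord0 k)) E.
  apply: (@affine_integrable _ _ (fun j t => u j (s + t)) B) => // [j|t /Da Dt|j t /Da Dt].
  + by apply: (@ae_translate _ s (fun t => `|u j t| <= B)).
  + exact: (@field_continuous f0 (sigma s w) (fun t => x (s + t))).
  + exact: (@field_continuous (f j) (sigma s w) (fun t => x (s + t))).
apply: Rintegral_ae_eq; first exact: measurable_itv.
- rewrite E; apply: affine_measurable => // [t /Da Dt|j t /Da Dt].
  + exact: (@field_continuous f0 (sigma s w) (fun t => x (s + t))).
  + exact: (@field_continuous (f j) (sigma s w) (fun t => x (s + t))).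
- exact: rhs_measurable.
have /ae_all us := fun j => Linfty_shiftE s (u j).
apply: (ae_imply _ us) => t ut _; rewrite (congr1 (fun g => g t) E) control_rhsE.
by congr (_ + _); apply: eq_bigr => j _; rewrite ut.
Qed.

Variable phi : R -> Omega -> M -> control U -> M.
Hypothesis phiP : solution_map sigma f0 f phi.

Lemma phi0 w x u : phi 0 w x u = x. Proof. by case: (phiP w x u). Qed.

Lemma phi_continuous w x u : continuous (fun t => phi t w x u).
Proof. by case: (phiP w x u) => -[]. Qed.

Lemma phi_solution_on w x u : solution_on setT w u (fun t => phi t w x u).
Proof. by have [/solution_onT[]] := phiP w x u. Qed.

Lemma phi_unique w x0 u x t : continuous x -> solution_on setT w u x ->
  x 0 = x0 -> x t = phi t w x0 u.
Proof. by move=> cx sx x00; case: (phiP w x0 u) => _ _; apply=> //; apply/solution_onT. Qed.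

(** The cocycle property. *)
Lemma phiD s t w x u :
  phi (s + t) w x u = phi t (sigma s w) (phi s w x u) (control_shift s u).
Proof.
apply: (@phi_unique _ _ _ (fun t => phi (s + t) w x u) t).
- move=> {}t; apply: (@continuous_comp _ _ _ (fun t => s + t) (fun t => phi t w x u)).
    by apply: cvgD; [exact: cvg_cst|exact: cvg_id].
  exact: phi_continuous.
- exact: (solution_on_shift (@phi_continuous w x u) (@phi_solution_on w x u)).
- by rewrite addr0.
Qed.

(** Uniqueness of global solutions implies local uniqueness: a solution z on [s, t]
    is prolonged to the line by phi before s and by the solution that starts at
    (sigma t w, z t) after t. *)
Lemma phi_unique_on (s t : R) w x u z : 0 <= s -> s <= t -> continuous z ->
  solution_on `[s, t]%classic w u z -> z s = phi s w x u -> z t = phi t w x u.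
Proof.
move=> s0 st cz sz zs.
(* the continuation after time t *)
pose y r := phi (- t + r) (sigma t w) (z t) (control_shift t u).
have cy : continuous y.
  move=> r; apply: (@continuous_comp _ _ _ (fun r => - t + r)
    (fun r => phi r (sigma t w) (z t) (control_shift t u))).
    by apply: cvgD; [exact: cvg_cst|exact: cvg_id].
  exact: phi_continuous.
have yt : y t = z t by rewrite /y addNr phi0.
have soly : solution_on setT w u y.
  have := solution_on_shift (s := - t) (@phi_continuous (sigma t w) (z t) (control_shift t u))
    (@phi_solution_on (sigma t w) (z t) (control_shift t u)).
  rewrite -flowD addNr flow0; apply: solution_on_ae => // k.
  apply: (ae_imply2 _ (Linfty_shiftE (- t) (control_shift t u k))
    (@ae_translate _ (- t) (fun r => control_shift t u k r = u k (t + r))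
      (Linfty_shiftE t (u k)))).
  by move=> r -> -> _; rewrite addrA subrr add0r.
pose c1 := glue s (fun r => phi r w x u) z.
have cc1 : continuous c1.
  by apply: glue_continuous => //; exact: phi_continuous.
have c1t : c1 t = z t.
  by rewrite /c1 /glue; case: leP => // ts; have -> : t = s by apply/le_anti; rewrite ts.
have solc1 : solution_on [set r | r <= t] w u c1.
  apply: solution_on_glue => //; first exact: phi_continuous.
    exact: solution_onS (@phi_solution_on w x u).
  by apply: solution_onS sz => r /= [rt sr]; rewrite in_itv/= sr.
have -> : z t = glue t c1 y t by rewrite /glue lexx c1t.
apply: phi_unique.
- by apply: glue_continuous => //; rewrite c1t.
- apply: solution_on_glue => //; first by rewrite c1t.
    by apply: solution_onS solc1 => r [].
  exact: solution_onS soly.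
- by rewrite /glue (le_trans s0 st) /c1 /glue s0 phi0.
Qed.

(** At positive times the solution depends only on the values of the control in between. *)
Lemma phi_control_local (t : R) w x (u v : control U) : 0 <= t ->
  (forall k, {ae mu, forall s, 0 < s -> s <= t -> u k s = v k s}) ->
  phi t w x u = phi t w x v.
Proof.
move=> t0 uv; apply: (@phi_unique_on 0 t _ _ _ (fun t => phi t w x u)) => //.
- exact: phi_continuous.
- apply: (@solution_on_ae _ _ u); first exact: phi_continuous.
    move=> k; apply: (ae_imply _ (ae_gt_ge (uv k))) => s us.
    by rewrite /= in_itv/= => /andP[]; exact: us.
  exact: solution_onS (@phi_solution_on w x u).
- by rewrite !phi0.
Qed.

(** * Continuous dependence on the base point *)

(** Limits of solutions are solutions.  The convergence is joint: X w s tends to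
    z r when w moves along G and s in [a, b] tends to r.  By compactness this is
    uniform on [a, b], so no chart has to be fixed in advance. *)
Lemma solution_on_limit (G : set_system Omega) (ws : Omega) (u : control U)
    (X : Omega -> R -> M) (z : R -> M) (a b : R) :
  ProperFilter G -> G --> ws ->
  (forall w, continuous (X w) /\ solution_on setT w u (X w)) ->
  continuous z ->
  (forall r, a <= r <= b -> forall V, nbhs (z r) V ->
    \forall s \near r & w \near G, a <= s <= b -> V (X w s)) ->
  solution_on `[a, b]%classic ws u z.
Proof.
move=> PG Gws Xsol cz joint i a' b' ab' D k.
have sub r : a' <= r <= b' -> a <= r <= b.
  by move=> /D[]; rewrite /= in_itv.
have Dz r : a' <= r <= b' -> chart_dom (A i) (z r) by move=> /D[].
have [B B0 uB] := control_bounded cptU.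
(* compactness of [a', b'] makes locally valid statements uniform *)
have cov (Q : Omega -> R -> Prop) :
    (forall r, a' <= r <= b' -> \forall s \near r & w \near G, a' <= s <= b' -> Q w s) ->
    \forall w \near G, forall s, a' <= s <= b' -> Q w s.
  move=> h; have /near_covering_withinP cv :=
    (compact_near_coveringP `[a', b']%classic).1 (@segment_compact _ a' b').
  have hQ r : `[a', b']%classic r ->
      \forall s \near r & w \near G, `[a', b']%classic s -> Q w s.
    rewrite /= in_itv/= => /h; apply: filterS => -[s w] /= Qsw sI.
    by apply: Qsw; move: sI; rewrite /= in_itv.
  apply: filterS (cv _ G Q _ hQ) => w cw s sab.
  by apply: cw; rewrite /= in_itv.
have Dnear : \forall w \near G, forall s, a' <= s <= b' -> chart_dom (A i) (X w s).
  apply: cov => r rab.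
  have oD : nbhs (z r) (chart_dom (A i)).
    by apply: open_nbhs_nbhs; split; [exact: chart_dom_open|exact: Dz].
  by apply: filterS (joint r (sub _ rab) _ oD) => -[s w] /= + /sub.
have fnear (g : Omega -> forall x : M, tangent A x) (e : R) : continuous_field g -> 0 < e ->
    \forall w \near G, forall s, a' <= s <= b' ->
      `|g (sigma s w) (X w s) i ord0 k - g (sigma s ws) (z s) i ord0 k| <= e.
  move=> cg e0; apply: cov => r rab.
  have e20 : 0 < e / 2 by rewrite divr_gt0.
  have := cvg_comp _ _ (cg i (sigma r ws) (z r) (Dz _ rab)) (@coord_continuous R 1 d ord0 k _).
  move=> /cvgrPdist_lt/(_ _ e20)[[V1 V2] /= [nV1 nV2] V12].
  have [[S1 W1] /= [nS1 nW1] SW1] : \forall p \near (r, ws), V1 (sigma p.1 p.2).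
    by case: flow => _ _ /(_ (r, ws)); apply.
  have [[S2 W2] /= [nS2 nW2] SW2] := joint r (sub _ rab) _ nV2.
  have := field_continuous (w := ws) (k := k) cg cz (Dz _ rab).
  move=> /cvgrPdist_lt/(_ _ e20) nS3.
  exists (S1 `&` S2 `&` [set s |
      `|g (sigma r ws) (z r) i ord0 k - g (sigma s ws) (z s) i ord0 k| < e / 2],
    W1 `&` W2).
    split => /=; last by apply: filterI => //; exact: Gws.
    by apply: filterI => //; exact: filterI.
  move=> [s w] /= [[[S1s S2s] S3s] [W1w W2w]] sab.
  have := V12 (sigma s w, X w s) _; rewrite /= => /(_ _)/ltW h1.
  rewrite (le_trans (ler_distD (g (sigma r ws) (z r) i ord0 k) _ _))// (splitr e) lerD//.
    rewrite distrC h1//; split; first exact: (SW1 (s, w)).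
    exact: (SW2 (s, w) (conj S2s W2w) (sub _ sab)).
  exact: ltW.
have xinear (r e : R) : a' <= r <= b' -> 0 < e ->
    \forall w \near G, `|chart_coord (A i) (X w r) ord0 k - chart_coord (A i) (z r) ord0 k| <= e.
  move=> rab e0.
  have := cvg_comp _ _ (chart_coord_continuous (Dz _ rab)) (@coord_continuous R 1 d ord0 k _).
  move=> /cvgrPdist_le/(_ _ e0) nV.
  have [[S2 W2] /= [nS2 nW2] SW2] := joint r (sub _ rab) _ nV.
  apply: filterS (nW2) => w W2w; rewrite distrC.
  exact: (SW2 (r, w) (conj (nbhs_singleton nS2) W2w) (sub _ rab)).
apply/eqP; rewrite -subr_eq0 -normr_le0; apply/ler_addgt0Pl => e e0; rewrite addr0.
(* the integrals differ by at most e / C * (1 + m B) (b' - a'), and the values at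
   each endpoint by at most e / C *)
pose C := (1 + m%:R * B) * (b' - a') + 1 + 1.
have C0 : 0 < C.
  by rewrite ltr_wpDl// addr_ge0// mulr_ge0 ?subr_ge0// addr_ge0// mulr_ge0.
have eC0 : 0 < e / C by rewrite divr_gt0.
have aab : a' <= a' <= b' by rewrite lexx.
have bab : a' <= b' <= b' by rewrite lexx andbT.
have fjnear : \forall w \near G, forall j, forall s, a' <= s <= b' ->
    `|f j (sigma s w) (X w s) i ord0 k - f j (sigma s ws) (z s) i ord0 k| <= e / C.
  by apply: filter_forall => j; exact: fnear.
have [w [[[[wD w0] wf] wa] wb]] := filter_ex (filterI (filterI (filterI (filterI Dnear
  (fnear f0 _ cf0 eC0)) fjnear)
  (xinear a' _ aab eC0)) (xinear b' _ bab eC0)).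
have [cX solX] := Xsol w.
have eqX : chart_coord (A i) (X w b') ord0 k - chart_coord (A i) (X w a') ord0 k =
      \int[mu]_(t in `[a', b']%classic) control_rhs sigma f0 f w u (X w) i t ord0 k.
  by apply: solX => // t /wD.
have bnd : `|\int[mu]_(t in `[a', b']%classic) control_rhs sigma f0 f w u (X w) i t ord0 k -
   \int[mu]_(t in `[a', b']%classic) control_rhs sigma f0 f ws u z i t ord0 k| <=
   e / C * (1 + m%:R * B) * (b' - a').
  rewrite -RintegralB//; last 2 first.
  - exact: (rhs_integrable w u k ab' cX wD).
  - exact: (rhs_integrable ws u k ab' cz Dz).
  rewrite [X in `|X|](_ : _ = \int[mu]_(t in `[a', b']%classic)
    ((f0 (sigma t w) (X w t) i ord0 k - f0 (sigma t ws) (z t) i ord0 k) +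
     \sum_(j < m) u j t *
       (f j (sigma t w) (X w t) i ord0 k - f j (sigma t ws) (z t) i ord0 k))); last first.
    apply: eq_Rintegral => t _; rewrite !control_rhsE opprD addrACA; congr (_ + _).
    by rewrite -sumrB; apply: eq_bigr => j _; rewrite mulrBr.
  apply: (proj2 (@affine_Rintegral_bound _ _ _ B _ _ _ _ _ _ _ _ _ _ _ _ _)) => //.
  - by move=> j; exact: measurable_control.
  - move=> s sab; apply: continuousB.
      exact: (field_continuous cf0 cX (wD _ sab)).
    exact: (field_continuous cf0 cz (Dz _ sab)).
  - move=> j s sab; apply: continuousB.
      exact: (field_continuous (w := w) (k := k) (@cf j) cX (wD _ sab)).
    exact: (field_continuous (w := ws) (k := k) (@cf j) cz (Dz _ sab)).
move: bnd; rewrite -eqX.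
set I := (X in `|_ - _ - X| <= _) => bnd.
have -> : e = e / C * (1 + m%:R * B) * (b' - a') + e / C + e / C.
  by rewrite -[LHS](@divfK _ C) ?gt_eqF// {2}/C; move: (e / C) => q; ring.
have -> : chart_coord (A i) (z b') ord0 k - chart_coord (A i) (z a') ord0 k - I =
  (chart_coord (A i) (X w b') ord0 k - chart_coord (A i) (X w a') ord0 k - I) +
  (chart_coord (A i) (X w a') ord0 k - chart_coord (A i) (z a') ord0 k)
  - (chart_coord (A i) (X w b') ord0 k - chart_coord (A i) (z b') ord0 k).
  by ring.
apply: (le_trans (ler_normB _ _)); apply: lerD => //.
by apply: (le_trans (ler_normD _ _)); apply: lerD.
Qed.

(** The points of the domain of chart i whose coordinates lie in the closed ball
    of centre y and radius r. *)
Definition chart_ball (i : atlas_index A) (y : 'rV[R]_d) (r : R) : set M :=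
  [set p | chart_dom (A i) p /\ `|chart_coord (A i) p - y| <= r].

(** Although it is defined inside an open chart domain, the chart ball is closed in
    M when the coordinate ball lies in the image of the chart, being the image of a
    compact set.  A curve therefore cannot leave the domain without leaving the
    ball first. *)
Lemma chart_ball_closed i y r :
  (forall y', `|y' - y| <= r -> (chart_coord (A i) @` chart_dom (A i)) y') ->
  closed (chart_ball i y r).
Proof.
move=> sub.
have -> : chart_ball i y r = chart_inv (A i) @` [set y' | `|y' - y| <= r].
  apply/seteqP; split=> [p [Dp pr]|_ [y' y'r <-]].
    by exists (chart_coord (A i) p) => //; exact: chart_coordK.
  by have [p Dp py] := sub _ y'r; rewrite -py chart_coordK//; split=> //; rewrite py.
apply: compact_closed; first exact: metric_hausdorff.
apply: continuous_compact; last exact: rV_closed_ball_compact.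
by apply: continuous_in_subspaceT => y'; rewrite inE/= => /sub; exact: chart_inv_continuous.
Qed.

Lemma chart_ball_nbhs i y r p : chart_dom (A i) p -> `|chart_coord (A i) p - y| < r ->
  nbhs p [set q | chart_dom (A i) q /\ `|chart_coord (A i) q - y| < r].
Proof.
move=> Dp pr; have nD : nbhs p (chart_dom (A i)).
  by apply: open_nbhs_nbhs; split=> //; exact: chart_dom_open.
have e0 : 0 < r - `|chart_coord (A i) p - y| by rewrite subr_gt0.
have nC : nbhs p [set q | `|chart_coord (A i) p - chart_coord (A i) q| <
    r - `|chart_coord (A i) p - y|].
  exact: ((cvgrPdist_lt _ _).1 (chart_coord_continuous Dp) _ e0).
apply: filterS2 nD nC => q Dq qp; split=> //.
rewrite -(subrKA (chart_coord (A i) p)) (le_lt_trans (ler_normD _ _))//.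
by rewrite -ltrBrDr distrC.
Qed.

(** The speed in a chart is bounded by c (1 + m B) where the fields are bounded by c. *)
Lemma solution_on_lipschitz w (u : control U) x i (a b c B : R) :
  continuous x -> solution_on setT w u x ->
  (forall k, {ae mu, forall s, `|u k s| <= B}) -> 0 <= B -> 0 <= c -> a <= b ->
  (forall s, a <= s <= b -> chart_dom (A i) (x s)) ->
  (forall s, a <= s <= b -> `|f0 (sigma s w) (x s) i| <= c) ->
  (forall j s, a <= s <= b -> `|f j (sigma s w) (x s) i| <= c) ->
  `|chart_coord (A i) (x b) - chart_coord (A i) (x a)| <= c * (1 + m%:R * B) * (b - a).
Proof.
move=> cx sx uB B0 c0 ab D f0c fc.
have K0 : 0 <= c * (1 + m%:R * B) by rewrite mulr_ge0// addr_ge0// mulr_ge0.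
apply: rV_norm_le => [|k]; first by rewrite mulr_ge0// subr_ge0.
rewrite !mxE (sx i a b ab) => [|t /D//].
rewrite (funext (fun t => control_rhsE w u x i t k)).
apply: (proj2 (@affine_Rintegral_bound _ _ _ B _ _ _ _ _ _ _ _ _ _ _ _ _)) => //.
- by move=> j; exact: measurable_control.
- by move=> s sab; exact: (field_continuous (w := w) (k := k) cf0 cx (D _ sab)).
- by move=> j s sab; exact: (field_continuous (w := w) (k := k) (@cf j) cx (D _ sab)).
- by move=> s sab; apply: le_trans (f0c _ sab); exact: rV_norm_coord.
- by move=> j s sab; apply: le_trans (fc j _ sab); exact: rV_norm_coord.
Qed.

(** A solution stays in the chart ball as long as the speed bound does not let it
    reach the boundary. *)
Lemma solution_on_stay w (u : control U) x i (y0 : 'rV[R]_d) (r a b c B : R) :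
  (forall y', `|y' - y0| <= r -> (chart_coord (A i) @` chart_dom (A i)) y') ->
  continuous x -> solution_on setT w u x ->
  (forall k, {ae mu, forall s, `|u k s| <= B}) -> 0 <= B -> 0 <= c ->
  (forall s, a <= s <= b -> chart_ball i y0 r (x s) -> `|f0 (sigma s w) (x s) i| <= c) ->
  (forall j s, a <= s <= b -> chart_ball i y0 r (x s) -> `|f j (sigma s w) (x s) i| <= c) ->
  chart_dom (A i) (x a) ->
  `|chart_coord (A i) (x a) - y0| + c * (1 + m%:R * B) * (b - a) < r ->
  forall s, a <= s <= b -> chart_ball i y0 r (x s).
Proof.
move=> sub cx sx uB B0 c0 f0c fc Da small.
have K0 : 0 <= c * (1 + m%:R * B) by rewrite mulr_ge0// addr_ge0// mulr_ge0.
move=> s0 s0ab; have ab : a <= b by have /andP[/le_trans h /h] := s0ab.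
move: s0 s0ab; apply: real_induction.
- split=> //; apply: ltW; apply: le_lt_trans small.
  by rewrite lerDl mulr_ge0// subr_ge0.
- move=> t at_ tb ball.
  have [Dt _] := ball t ltac:(by rewrite at_ lexx).
  have tr : `|chart_coord (A i) (x t) - y0| < r.
    apply: le_lt_trans small; rewrite -(subrKA (chart_coord (A i) (x a))) addrC.
    apply: (le_trans (ler_normD _ _)); rewrite lerD2l.
    apply: (@le_trans _ _ (c * (1 + m%:R * B) * (t - a))).
      apply: solution_on_lipschitz sx uB B0 c0 at_ _ _ _ => //
        [s /ball[]//|s /[dup] sat /ball|j s /[dup] sat /ball].
        by apply: f0c; have /andP[-> /le_trans ->] := sat; rewrite // ltW.
      by apply: fc; have /andP[-> /le_trans ->] := sat; rewrite // ltW.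
    by rewrite ler_wpM2l// lerD2r ltW.
  have := cx t _ (chart_ball_nbhs Dt tr); rewrite /nbhs/= => -[e /= e0 te].
  exists e => // s ts ste _; have [Ds /ltW sr] : [set q | chart_dom (A i) q /\
      `|chart_coord (A i) q - y0| < r] (x s).
    by apply: te; rewrite /= ltr0_norm ?subr_lt0// opprB ltrBlDl.
  by [].
- move=> t at_ tb ball.
  apply: (@closed_cvg _ _ (t^'-) _ (x : R -> M) (chart_ball i y0 r)).
  + exact: chart_ball_closed.
  + near=> s; apply: ball; apply/andP; split.
      by near: s; apply: nbhs_left_ge.
    by near: s; exact: nbhs_left_lt.
  + apply: cvg_at_left_filter; exact: cx.
Unshelve. all: by end_near. Qed.

Lemma field_locally_bounded (g : Omega -> forall x : M, tangent A x) i w p :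
  continuous_field g -> chart_dom (A i) p ->
  \forall q \near (w, p), `|g q.1 q.2 i| <= `|g w p i| + 1.
Proof.
move=> cg Dp.
have near1 : \forall q \near (w, p), `|g w p i - g q.1 q.2 i| < 1.
  exact: ((cvgrPdist_lt _ _).1 (cg i w p Dp) _ ltr01).
apply: filterS near1 => q /ltW h.
by rewrite -[g q.1 q.2 i](subrK (g w p i)) addrC (le_trans (ler_normD _ _))// lerD2l distrC.
Qed.

(** A chart ball around p and a common bound of the fields on it, valid for the
    base points sigma s w with s close to t0 and w close to ws. *)
Lemma chart_flow_box (ws : Omega) (p : M) (t0 : R) : exists i : atlas_index A,
  chart_dom (A i) p /\ exists r c : R,
  [/\ 0 < r, 0 <= c,
    forall y', `|y' - chart_coord (A i) p| <= r -> (chart_coord (A i) @` chart_dom (A i)) y' &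
    \forall s \near t0 & w \near ws, forall q, chart_ball i (chart_coord (A i) p) r q ->
       `|f0 (sigma s w) q i| <= c /\ forall j, `|f j (sigma s w) q i| <= c].
Proof.
have [i Dp] := atlas_cover A p; exists i; split=> //.
set y0 := chart_coord (A i) p.
pose c := `|f0 (sigma t0 ws) p i| + 1 + \sum_j (`|f j (sigma t0 ws) p i| + 1).
have sum_ge0 (P : pred 'I_m) : 0 <= \sum_(j | P j) (`|f j (sigma t0 ws) p i| + 1).
  by apply: sumr_ge0 => j _; rewrite addr_ge0.
have near_c : \forall q \near (sigma t0 ws, p), `|f0 q.1 q.2 i| <= c /\
    forall j, `|f j q.1 q.2 i| <= c.
  have h0 := field_locally_bounded (sigma t0 ws) cf0 Dp.
  have hj : \forall q \near (sigma t0 ws, p), forall j,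
      `|f j q.1 q.2 i| <= `|f j (sigma t0 ws) p i| + 1.
    apply: (@filter_forall _ _ (fun j (q : Omega * M) => _) (nbhs (sigma t0 ws, p))) => j.
    exact: (field_locally_bounded (sigma t0 ws) (@cf j) Dp).
  apply: filterS2 h0 hj => q q0 qj; split=> [|j].
    by rewrite (le_trans q0)// lerDl.
  apply: (le_trans (qj j)); rewrite /c (bigD1 j)//= addrCA lerDl.
  by rewrite addr_ge0// addr_ge0.
have [[V N] /= [nV nN] VN] := near_c.
have [[S W] /= [nS nW] SW] : \forall q \near (t0, ws), V (sigma q.1 q.2).
  by case: flow => _ _ /(_ (t0, ws)); apply.
have imgy0 : (chart_coord (A i) @` chart_dom (A i)) y0 by exists p.
have : nbhs y0 ((chart_coord (A i) @` chart_dom (A i)) `&` (chart_inv (A i) @^-1` N)).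
  apply: filterI; first by apply: open_nbhs_nbhs; split=> //; exact: chart_img_open.
  by apply: (chart_inv_continuous imgy0); rewrite chart_coordK.
move=> /nbhs_normP[e /= e0 ye].
exists (e / 2), c; split.
- by rewrite divr_gt0.
- by rewrite /c addr_ge0// addr_ge0.
- move=> y' y'e; apply: (proj1 (ye y' _)).
  by rewrite /= distrC (le_lt_trans y'e)// ltr_pdivrMr// ltr_pMr// ltr1n.
- exists (S, W) => // -[s w] /= [Ss Ww] q [Dq qe].
  apply: (VN (sigma s w, q)); split=> /=; first exact: (SW (s, w)).
  have qe' : `|y0 - chart_coord (A i) q| < e.
    by rewrite distrC (le_lt_trans qe)// ltr_pdivrMr// ltr_pMr// ltr1n.
  by have [_] := ye _ qe'; rewrite /= chart_coordK.
Qed.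

(** Convergence along an ultrafilter G that converges to ws. *)
Section ultra.
Variables (G : set_system Omega) (ws : Omega) (x0 : M) (u : control U).
Hypotheses (GU : UltraFilter G) (Gws : G --> ws).
Let X w t := phi t w x0 u.

(** Around any time t0 there is a time interval, independent of s and t, on which
    convergence propagates from s forward to t. *)
Lemma phi_ultra_cvg_local t0 : exists2 e, 0 < e & forall s t, 0 <= s -> s <= t ->
  `|s - t0| < e -> `|t - t0| < e -> X ^~ s @ G --> X ws s -> X ^~ t @ G --> X ws t.
Proof.
have cX w : continuous (X w) by move=> q; exact: phi_continuous.
have sX w : solution_on setT w u (X w) by move=> j a b ab D k; exact: phi_solution_on.
have [B B0 uB] := control_bounded cptU.
have [i [Dp [r [c [r0 c0 sub box]]]]] := chart_flow_box ws (X ws t0) t0.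
set y0 := chart_coord (A i) (X ws t0) in sub box *.
(* common speed bound of the solutions over base points near ws *)
pose K := c * (1 + m%:R * B).
have K0 : 0 <= K by rewrite /K mulr_ge0// addr_ge0// mulr_ge0.
have [[S W] /= [nS nW] SW] := box.
have r20 : 0 < r / 2 by rewrite divr_gt0.
have y0y0 : `|y0 - y0| < r / 2 by rewrite subrr normr0.
have nX : nbhs t0 [set s | chart_dom (A i) (X ws s) /\
    `|chart_coord (A i) (X ws s) - y0| < r / 2].
  exact: (cX ws t0 _ (chart_ball_nbhs Dp y0y0)).
have : nbhs t0 (S `&` [set s | chart_dom (A i) (X ws s) /\
    `|chart_coord (A i) (X ws s) - y0| < r / 2]) by exact: filterI.
move=> /nbhs_normP[e1 /= e10 SXe].
(* between two times at distance less than e2 from t0, the solutions move by less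
   than r / 2 *)
pose e2 := r / 2 / (K + K + 1).
have KK0 : 0 < K + K + 1 by rewrite ltr_wpDl// addr_ge0.
have e20 : 0 < e2 by rewrite divr_gt0.
exists (Num.min e1 e2) => [|s t s0 st]; first by rewrite lt_min e10.
rewrite !lt_min => /andP[se1 se2] /andP[te1 te2] Xs.
have Ke : K * (t - s) < r / 2.
  have ts : t - s <= e2 + e2.
    have -> : t - s = (t - t0) + (t0 - s) by ring.
    by rewrite lerD// (le_trans (ler_norm _))// ltW// distrC.
  apply: (le_lt_trans (ler_wpM2l K0 ts)).
  have e2E : e2 * (K + K + 1) = r / 2 by rewrite /e2 divfK ?gt_eqF.
  have -> : K * (e2 + e2) = e2 * (K + K + 1) - e2 by ring.
  by rewrite e2E ltrBlDr ltrDl.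
have [_ Xs_near] : (S `&` [set s | chart_dom (A i) (X ws s) /\
    `|chart_coord (A i) (X ws s) - y0| < r / 2]) s.
  by apply: SXe; rewrite /= distrC.
case: Xs_near => Ds Xsr.
(* for most w, the solution stays in the chart ball on [s, t] and is K-Lipschitz *)
have good : \forall w \near G, (forall q, s <= q <= t -> chart_ball i y0 r (X w q)) /\
   (forall q q', s <= q <= t -> s <= q' <= t ->
     `|chart_coord (A i) (X w q) - chart_coord (A i) (X w q')| <= K * `|q - q'|).
  have nXs : \forall w \near G, chart_dom (A i) (X w s) /\
      `|chart_coord (A i) (X w s) - y0| < r / 2.
    exact: (Xs _ (chart_ball_nbhs Ds Xsr)).
  apply: filterS2 (Gws nW) nXs => w Ww [Dws wsr].
  have Sq q : s <= q <= t -> S q.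
    move=> /andP[sq qt]; have [] // := SXe q _.
    move: se1 te1; rewrite /= !ltr_norml => /andP[? ?] /andP[? ?]; apply/andP; split; lra.
  have bnd q : s <= q <= t -> chart_ball i y0 r (X w q) ->
     `|f0 (sigma q w) (X w q) i| <= c /\ forall j, `|f j (sigma q w) (X w q) i| <= c.
    by move=> /Sq Sq' ; exact: (SW (q, w)).
  have stay q : s <= q <= t -> chart_ball i y0 r (X w q).
    apply: (solution_on_stay sub (cX w) (sX w) (uB u) B0 c0).
    - by move=> q' /bnd h /h[].
    - by move=> j q' /bnd h /h[].
    - exact: Dws.
    - by rewrite (splitr r) ltrD.
  split=> // q q'; wlog qq' : q q' / q <= q'.
    move=> h qst q'st; have [qq'|/ltW q'q] := leP q q'; first exact: h.
    by rewrite distrC [in leRHS]distrC; exact: h.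
  move=> /andP[sq _] /andP[_ q't].
  rewrite distrC [`|q - _|]distrC (@ger0_norm _ (q' - q)) ?subr_ge0//.
  have qst v : q <= v <= q' -> s <= v <= t.
    by move=> /andP[qv vq']; rewrite (le_trans sq qv) (le_trans vq' q't).
  apply: (solution_on_lipschitz (cX w) (sX w) (uB u) B0 c0 qq').
  - by move=> v /qst/stay[].
  - by move=> v /qst vst; case: (bnd v vst (stay v vst)).
  - by move=> j v /qst vst; case: (bnd v vst (stay v vst)).
(* the limit curve, in coordinates, is constant outside [s, t] *)
pose cl q := Num.max s (Num.min t q).
have clst q : s <= cl q <= t by rewrite /cl le_max lexx/= ge_max st ge_min lexx.
have clid q : s <= q <= t -> cl q = q.
  by move=> /andP[sq qt]; rewrite /cl (min_idPr qt) (max_idPr sq).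
have clL q q' : `|cl q - cl q'| <= `|q - q'|.
  exact: clamp_lipschitz.
have /choice[z zP] : forall q, exists y, `|y - y0| <= r /\
    (fun w => chart_coord (A i) (X w (cl q))) @ G --> y.
  move=> q.
  have [||l Kl cvl] := @ultra_cvg_compact _ _ G (fun w => chart_coord (A i) (X w (cl q)))
     [set y' | `|y' - y0| <= r].
  - exact: rV_closed_ball_compact.
  - by apply: filterS good => w [/(_ _ (clst q))[]].
  - by exists l.
have zL q q' : `|z q - z q'| <= K * `|q - q'|.
  apply/ler_addgt0Pr => e e0; have e20' : 0 < e / 2 by rewrite divr_gt0.
  have nq : \forall w \near G, `|z q - chart_coord (A i) (X w (cl q))| < e / 2.
    exact: ((cvgrPdist_lt _ _).1 (zP q).2 _ e20').
  have nq' : \forall w \near G, `|z q' - chart_coord (A i) (X w (cl q'))| < e / 2.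
    exact: ((cvgrPdist_lt _ _).1 (zP q').2 _ e20').
  have [w [[_ wL] [wq wq']]] := filter_ex (filterI good (filterI nq nq')).
  set a := chart_coord (A i) (X w (cl q)) in wq.
  set a' := chart_coord (A i) (X w (cl q')) in wq'.
  have -> : z q - z q' = (a - a') + ((z q - a) - (z q' - a')).
    by apply/rowP => k; rewrite !mxE; ring.
  apply: (le_trans (ler_normD _ _)); apply: lerD.
    by apply: (le_trans (wL _ _ (clst q) (clst q'))); rewrite ler_wpM2l.
  by apply: (le_trans (ler_normB _ _)); rewrite (splitr e) lerD// ltW.
have zD q : (chart_coord (A i) @` chart_dom (A i)) (z q) by apply: sub; case: (zP q).
have K10 : 0 < K + 1 by rewrite ltr_wpDl.
have Kball e q q' : 0 < e -> `|q - q'| < e / (K + 1) -> K * `|q - q'| < e.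
  move=> e0 qe; apply: (@le_lt_trans _ _ ((K + 1) * `|q - q'|)).
    by rewrite ler_wpM2r// lerDl.
  by rewrite mulrC -ltr_pdivlMr.
have cz : continuous (fun q => chart_inv (A i) (z q)).
  move=> q; have zc : z @ q --> z q.
    apply/cvgrPdist_lt => e e0; apply/nbhs_normP; exists (e / (K + 1)) => /=.
      by rewrite divr_gt0.
    by move=> q' qq'; apply: le_lt_trans (zL _ _) _; exact: Kball.
  exact: (cvg_comp _ _ zc (chart_inv_continuous (zD q))).
have joint q : s <= q <= t -> forall V, nbhs (chart_inv (A i) (z q)) V ->
    \forall v \near q & w \near G, s <= v <= t -> V (X w v).
  move=> qst V /(chart_inv_continuous (zD q)) nV.
  have /nbhs_normP[e /= e0 zV] : nbhs (z q) (chart_inv (A i) @^-1` V) by exact: nV.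
  have e20' : 0 < e / 2 by rewrite divr_gt0.
  have nq : \forall w \near G, `|z q - chart_coord (A i) (X w q)| < e / 2.
    move: (zP q).2; rewrite clid// => zc.
    exact: ((cvgrPdist_lt _ _).1 zc _ e20').
  exists ([set v | `|q - v| < e / 2 / (K + 1)],
    [set w | ((forall q, s <= q <= t -> chart_ball i y0 r (X w q)) /\
      (forall q q', s <= q <= t -> s <= q' <= t ->
        `|chart_coord (A i) (X w q) - chart_coord (A i) (X w q')| <= K * `|q - q'|)) /\
      `|z q - chart_coord (A i) (X w q)| < e / 2]).
    split=> /=; last exact: filterI.
    by apply/nbhs_normP; exists (e / 2 / (K + 1)) => //=; rewrite divr_gt0.
  move=> [v w] /= [qv [[wball wL] wq]] vst.
  have [Dv _] := wball v vst.
  rewrite -(chart_coordK Dv); apply: zV => /=.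
  rewrite -(subrKA (chart_coord (A i) (X w q))) (splitr e).
  apply: (le_lt_trans (ler_normD _ _)); rewrite ltrD//.
  by apply: (le_lt_trans (wL _ _ qst vst)); exact: Kball.
have zs : chart_inv (A i) (z s) = X ws s.
  have := (zP s).2; rewrite clid ?lexx// => cvs.
  have cvs' : (fun w => chart_coord (A i) (X w s)) @ G --> chart_coord (A i) (X ws s).
    apply: (@continuous_cvg _ _ _ G _ (X ^~ s) (chart_coord (A i)) (X ws s)) => //.
    exact: chart_coord_continuous.
  have -> : z s = chart_coord (A i) (X ws s).
    by apply: (cvg_unique _ cvs cvs').
  by rewrite chart_coordK.
(* the limit curve is a solution over ws, hence the solution *)
have zt : chart_inv (A i) (z t) = X ws t.
  apply: (phi_unique_on s0 st cz _ zs).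
  apply: (solution_on_limit _ Gws _ cz joint).
  by move=> w; split.
move=> V; rewrite -zt => Vz.
have [[N N'] /= [nN nN'] NN'] := joint t ltac:(by rewrite st lexx) V Vz.
apply: filterS nN' => w N'w; apply: (NN' (t, w)); last by rewrite /= st lexx.
by split=> //=; exact: nbhs_singleton.
Qed.

Lemma phi_ultra_cvg T : 0 <= T -> X ^~ T @ G --> X ws T.
Proof.
move=> T0; have T0T : 0 <= T <= T by rewrite T0 lexx.
move: T0T; apply: (@real_induction _ (fun t => X ^~ t @ G --> X ws t)).
- rewrite /X phi0 (_ : (fun _ => _) = cst x0); first exact: cvg_cst.
  by apply/funext => w; rewrite phi0.
- move=> t t0 tT ht; have [e e0 he] := phi_ultra_cvg_local t.
  exists e => // s ts ste _; apply: (he t s) => //; rewrite ?subrr ?normr0 ?(ltW ts)//.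
    by rewrite gtr0_norm ?subr_gt0// ltrBlDl.
  by apply: ht; rewrite t0 lexx.
- move=> t t0 tT ht; have [e e0 he] := phi_ultra_cvg_local t.
  pose s := Num.max 0 (t - e / 2).
  have st : s < t by rewrite gt_max t0 ltrBlDr ltrDl divr_gt0.
  apply: (he s t); rewrite ?le_max ?lexx ?subrr ?normr0 ?(ltW st)//.
    rewrite ltr0_norm ?subr_lt0// opprB ltrBlDl -ltrBlDr lt_max.
    by apply/orP; right; rewrite ltrD2l ltrN2 ltr_pdivrMr// ltr_pMr// ltr1n.
  by apply: ht; rewrite le_max lexx.
Qed.

End ultra.

Lemma phi_base_continuous T ws x0 u : 0 <= T ->
  {for ws, continuous (fun w => phi T w x0 u)}.
Proof.
move=> T0; apply: cvg_ultra => G GU Gws; exact: phi_ultra_cvg.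
Qed.

(** * Chains *)

Variable dU : control U -> control U -> R.

Lemma Phi_chain_one eps T t u w x v w' y : T <= t ->
  dU (control_shift t u) v < eps -> mdist (phi t w x u) y < eps ->
  mdist (sigma t w) w' < eps ->
  Phi_chain sigma phi dU eps T (u, w, x) (v, w', y).
Proof.
move=> Tt du dx dw.
exists 1%N, (fun j => if j is 0%N then u else v),
  (fun j => if j is 0%N then w else sigma t w),
  (fun j => if j is 0%N then x else y), (fun=> t).
by split=> // -[|//] _; split=> //; rewrite gt_max du.
Qed.

Lemma Phi_chain_cons eps T t u w x u1 x1 q : T <= t ->
  dU (control_shift t u) u1 < eps -> mdist (phi t w x u) x1 < eps ->
  Phi_chain sigma phi dU eps T (u1, sigma t w, x1) q ->
  Phi_chain sigma phi dU eps T (u, w, x) q.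
Proof.
move=> Tt du dx [n [us [ws [xs [Ts [n0 [us0 ws0 xs0] end_ dw steps]]]]]].
exists n.+1, (fun j => if j is j'.+1 then us j' else u),
  (fun j => if j is j'.+1 then ws j' else w),
  (fun j => if j is j'.+1 then xs j' else x),
  (fun j => if j is j'.+1 then Ts j' else t).
split=> // -[_|j jn]; last exact: steps.
by split=> //=; rewrite us0 xs0 gt_max du.
Qed.

Lemma state_projection_transitive (EE : set (control U * Omega * M)) :
  Phi_invariant sigma phi EE -> chain_transitive sigma phi dU EE ->
  controlled_chain_transitive sigma phi (state_projection EE).
Proof.
move=> inv [[[[u w] x] EEx] trans]; split.
- by exists (w, x), u.
- move=> w1 x1 [v EEv]; exists v => t; exists (control_shift t v) => /=.
  by apply: (inv t); exists (v, w1, x1).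
- move=> [w1 x1] [w2 x2] [u1 E1] [u2 E2] eps T eps0 T0.
  have [n [us [ws [xs [Ts [n0 [_ ws0 xs0] [_ xsn] dw steps]]]]]] :=
    trans _ _ E1 E2 eps T eps0 T0.
  exists n, ws, xs, us, Ts; split=> //; first by rewrite ws0 xs0.
  by move=> j /steps[Tj wj]; rewrite gt_max => /andP[].
Qed.

Hypothesis dU_metric : is_metric dU.
Hypothesis dU_weak : weak_star_compatible dU.

Lemma control_lift_invariant (E : set (Omega * M)) :
  Phi_invariant sigma phi (control_lift sigma phi E).
Proof.
move=> t _ [[[u w] x] Eu <-] s /=.
have := Eu (t + s); rewrite /psi phiD.
by rewrite addrC flowD.
Qed.

(** The chain between two points of the lift consists of one step of length T along
    u, one of length S along a control close to the shift of u, the steps of a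
    controlled chain, and one of length S' that ends near (v, w', y). *)
Lemma control_lift_transitive (E : set (Omega * M)) :
  controlled_chain_transitive sigma phi E ->
  chain_transitive sigma phi dU (control_lift sigma phi E).
Proof.
move=> [[[w0 x0] E0] viable chains]; split.
  by have [u Eu] := viable _ _ E0; exists (u, w0, x0).
move=> [[u w] x] [[v w'] y] Eu Ev eps T eps0 T0.
have [_ dU0 dUC _] := dU_metric.
have dUxx z : dU z z < eps by rewrite (dU0 z z).2.
have mdxx (z : M) : mdist z z < eps by rewrite mdistxx.
have [N N0 uN] := weak_star_tail cptU (control_shift T u) dU_metric dU_weak eps0.
have [N' N'0 vN'] := weak_star_tail cptU v dU_metric dU_weak eps0.
pose S := N + T; pose S' := N' + T.
have TS : T <= S by rewrite lerDr.
have TS' : T <= S' by rewrite lerDr.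
have S0 : 0 <= S := le_trans (ltW T0) TS.
have S'0 : 0 <= S' := le_trans (ltW T0) TS'.
(* the state at time - S' of the trajectory through (v, w', y) *)
pose v1 := control_shift (- S') v; pose x1 := phi (- S') w' y v.
pose w1 := sigma (- S') w'.
have w1E : sigma S' w1 = w' by rewrite -flowD subrr flow0.
have x1E : phi S' w1 x1 v1 = y.
  by rewrite -phiD addNr phi0.
have [delta delta0 near_w1] : exists2 delta, 0 < delta & forall z, mdist w1 z < delta ->
    mdist (phi S' z x1 v1) y < eps /\ mdist (sigma S' z) w' < eps.
  have cphi : {for w1, continuous (fun z => phi S' z x1 v1)}.
    exact: (phi_base_continuous S'0).
  have csig : {for w1, continuous (sigma S')}.
    case: flow => _ _ cs.
    exact: (cvg_comp2 (cvg_cst S') cvg_id (cs (S', w1))).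
  have n1 : \forall z \near w1, mdist (phi S' z x1 v1) y < eps.
    have yball : nbhs (phi S' w1 x1 v1) (ball y eps).
      by rewrite x1E; exact: nbhsx_ballx.
    have n1 : \forall z \near w1, ball y eps (phi S' z x1 v1) by exact: (cphi _ yball).
    by apply: filterS n1 => z; rewrite ballEmdist /= metric_sym.
  have n2 : \forall z \near w1, mdist (sigma S' z) w' < eps.
    have wball : nbhs (sigma S' w1) (ball w' eps).
      by rewrite w1E; exact: nbhsx_ballx.
    have n2 : \forall z \near w1, ball w' eps (sigma S' z) by exact: (csig _ wball).
    by apply: filterS n2 => z; rewrite ballEmdist /= metric_sym.
  have /nbhs_ballP[delta /= delta0 h] : nbhs w1 [set z | mdist (phi S' z x1 v1) y < eps /\
      mdist (sigma S' z) w' < eps] by exact: filterI n1 n2.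
  by exists delta => // z zd; apply: h; rewrite ballEmdist.
pose eps' := Num.min eps delta.
have eps'0 : 0 < eps' by rewrite lt_min eps0.
have [n [ws [xs [us [Ts [n0 [ws0 xs0] /= xsn dwn steps]]]]]] :=
  chains _ _ (Eu (T + S)) (Ev (- S')) eps' T eps'0 T0.
(* By induction from the end of the chain: nu is the concatenation of the last j
   controls and of v1, and every control that agrees with it at positive times
   works, so that the shift of a longer concatenation can be plugged in. *)
have suffix j : (j <= n)%N -> exists nu : control U, forall nu' : control U,
    (forall k, {ae mu, forall s, 0 < s -> nu' k s = nu k s}) ->
    Phi_chain sigma phi dU eps T (nu', ws (n - j)%N, xs (n - j)%N) (v, w', y).
  elim: j => [_|j IH jn].
    rewrite subn0; exists v1 => nu' nu'v1.
    have [dphi dsig] : mdist (phi S' (ws n) x1 v1) y < eps /\ mdist (sigma S' (ws n)) w' < eps.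
      apply: near_w1; rewrite metric_sym; apply: (lt_le_trans dwn).
      by rewrite ge_min lexx orbT.
    apply: (Phi_chain_one TS') => //.
      rewrite dUC; apply: vN' => k.
      have v1S := @ae_translate _ S' (fun s => v1 k s = v k (- S' + s))
        (Linfty_shiftE (- S') (v k)).
      have nuS := @ae_translate _ S' (fun s => 0 < s -> nu' k s = v1 k s) (nu'v1 k).
      apply: (ae_imply2 _ (Linfty_shiftE S' (nu' k)) (ae_imply2 (fun _ => @conj _ _) v1S nuS)).
      move=> s -> [v1s nus]; rewrite ler_norml => /andP[Ns _].
      rewrite nus ?v1s ?addKr// -ltrBlDl sub0r (lt_le_trans _ Ns)// ltrN2.
      by rewrite /S' ltrDl.
    rewrite xsn (@phi_control_local S' _ _ nu' v1)// => k.
    by apply: ae_imply (nu'v1 k) => s h /h.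
  have [nu nuP] := IH (ltnW jn).
  have nj : (n - j.+1 < n)%N by rewrite ltn_subrL.
  have njE : (n - j.+1).+1 = (n - j)%N by rewrite -subSn.
  set i := (n - j.+1)%N in nj njE *.
  have [Ti wi di] := steps _ nj; rewrite njE in wi di.
  have Ti0 : 0 < Ts i := lt_le_trans T0 Ti.
  have [mu_i mu_iP] := control_concat cptU (Ts i) (us i) nu.
  exists mu_i => nu' nu'mu.
  apply: (Phi_chain_cons (t := Ts i) (u1 := control_shift (Ts i) nu') (x1 := xs (n - j)%N)) => //.
    rewrite (@phi_control_local _ _ _ nu' (us i)) ?(ltW Ti0)//.
      by apply: lt_le_trans di _; rewrite ge_min lexx.
    move=> k; apply: (ae_imply2 _ (nu'mu k) (mu_iP k)) => s h [h1 _] s0 sT.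
    by rewrite h// h1.
  rewrite wi; apply: nuP => k.
  have nu'S := @ae_translate _ (Ts i) (fun s => 0 < s -> nu' k s = mu_i k s) (nu'mu k).
  have muS := @ae_translate _ (Ts i) (fun s => (s <= Ts i -> mu_i k s = us i k s) /\
    (Ts i < s -> mu_i k s = nu k (- Ts i + s))) (mu_iP k).
  apply: (ae_imply2 _ (Linfty_shiftE (Ts i) (nu' k)) (ae_imply2 (fun _ => @conj _ _) nu'S muS)).
  move=> s -> [h [_ h1]] s0.
  by rewrite h ?addr_gt0// h1 ?addKr// ltrDl.
have [nu nuP] := suffix n (leqnn n).
have [mu0 mu0P] := control_concat cptU S (control_shift T u) nu.
rewrite subnn in nuP.
apply: (Phi_chain_cons (t := T) (u1 := mu0) (x1 := phi T w x u)) => //.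
  apply: uN => k; apply: (ae_imply _ (mu0P k)) => s [h _] sN.
  by rewrite h// (le_trans (ler_norm _))// (le_trans sN)// lerDl ltW.
have xs0E : phi S (sigma T w) (phi T w x u) mu0 = xs 0%N.
  rewrite (@phi_control_local _ _ _ mu0 (control_shift T u))//.
    by rewrite xs0 [RHS]phiD.
  by move=> k; apply: (ae_imply _ (mu0P k)) => s [h _] _; exact: h.
have ws0E : sigma S (sigma T w) = ws 0%N by rewrite -flowD addrC.
apply: (Phi_chain_cons (t := S) (u1 := control_shift S mu0) (x1 := xs 0%N)) => //.
  by rewrite xs0E.
rewrite ws0E; apply: nuP => k.
have muS := @ae_translate _ S (fun s => (s <= S -> mu0 k s = control_shift T u k s) /\
  (S < s -> mu0 k s = nu k (- S + s))) (mu0P k).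
apply: (ae_imply2 _ (Linfty_shiftE S (mu0 k)) muS) => s -> [_ h] s0.
by rewrite h ?addKr// ltrDl.
Qed.

End control_system.

Theorem theorem25 (R : realType) (d m : nat) (Omega M : metricType R)
    (A : smooth_atlas R d M) (U : set 'rV[R]_m)
    (sigma : R -> Omega -> Omega)
    (f0 : Omega -> forall x : M, tangent A x)
    (f : 'I_m -> Omega -> forall x : M, tangent A x)
    (phi : R -> Omega -> M -> control U -> M)
    (dU : control U -> control U -> R) :
  @second_countable M -> connected [set: M] ->
  compact [set: Omega] -> continuous_flow sigma -> minimal_flow sigma ->
  continuous_field f0 -> (forall i, continuous_field (f i)) ->
  (forall w, C1_vector_field (f0 w)) ->
  (forall i w, C1_vector_field (f i w)) ->
  compact U -> convex_set (U : set (convex_lmodType 'rV[R]_m)) ->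
  is_metric dU -> weak_star_compatible dU ->
  solution_map sigma f0 f phi ->
  (forall E : set (Omega * M),
     chain_control_set sigma phi E ->
     maximal_invariant_chain_transitive sigma phi dU (control_lift sigma phi E)) /\
  (forall EE : set (control U * Omega * M),
     maximal_invariant_chain_transitive sigma phi dU EE ->
     chain_control_set sigma phi (state_projection EE)).
Proof.
move=> _ _ _ flow _ cf0 cf _ _ cptU _ dU_metric dU_weak phiP.
have inv E := control_lift_invariant flow cf0 cf cptU phiP (E := E).
have trans E := control_lift_transitive flow cf0 cf cptU phiP dU_metric dU_weak (E := E).
have lift_sub (EE : set (control U * Omega * M)) E : Phi_invariant sigma phi EE ->
    state_projection EE `<=` E -> EE `<=` control_lift sigma phi E.
  move=> EEinv EEE [[u w] x] EEu t; apply: EEE; exists (control_shift t u) => /=.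
  by apply: (EEinv t); exists (u, w, x).
split=> [E [Etrans Emax]|EE [EEinv EEtrans EEmax]].
- split=> [||EE' EE'inv EE'trans sub]; [exact: inv|exact: trans|].
  have projE : state_projection EE' = E.
    apply: Emax; first exact: state_projection_transitive EE'trans.
    move=> [w x] Ewx; have [_ viable _] := Etrans; have [u Eu] := viable _ _ Ewx.
    by exists u; apply: sub.
  by apply/seteqP; split=> //; apply: lift_sub => //; rewrite projE.
- split=> [|E' E'trans sub]; first exact: state_projection_transitive EEtrans.
  have liftE : control_lift sigma phi E' = EE.
    by apply: EEmax; [exact: inv|exact: trans|exact: lift_sub].
  apply/seteqP; split=> // -[w x] E'wx; have [_ viable _] := E'trans.
  by have [u E'u] := viable _ _ E'wx; exists u; rewrite -liftE.
Qed.
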